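(* Let $n\ge1$ and let $\Sigma\subset\mathbb{S}^{2n}_+$ be a spherical cap, with associated parameter $\alpha_\Sigma>0$. Then $$c_n(\Sigma)\ \ge\ \frac{n}{\alpha_\Sigma}\,\frac{16\pi^3}{16+\alpha_\Sigma^2}.$$ In particular, $c_n(\Sigma)\to+\infty$ as $\Sigma$ degenerates to a point (that is, as $\alpha_\Sigma\to0^+$).
   Context: The Heisenberg group $\mathbb{H}^n$ is $\mathbb{R}^{2n+1}$ with points $(x,y,z)\in\mathbb{R}^n\times\mathbb{R}^n\times\mathbb{R}$, endowed with the sub-Riemannian structure whose (horizontal) distribution $\mathcal{D}$ has orthonormal frame $$X_i=\partial_{x_i}-\frac{y_i}{2}\partial_z,\qquad Y_i=\partial_{y_i}+\frac{x_i}{2}\partial_z,\qquad i=1,\dots,n,$$ with associated norm $|\cdot|$ on $\mathcal{D}$. The Carnot-Carathéodory distance from the origin is $\delta(p)=\inf\int_0^1|\dot\gamma(t)|\,dt$, over absolutely continuous curves $\gamma:[0,1]\to\mathbb{H}^n$ with $\dot\gamma(t)\in\mathcal{D}_{\gamma(t)}$ for a.e. $t$, $\gamma(0)=0$, $\gamma(1)=p$. The horizontal gradient is $\nabla_{\mathbb{H}}u=\sum_{i=1}^n\big((X_iu)X_i+(Y_iu)Y_i\big)$. Integration $dp$ is with respect to Lebesgue measure. Let $\varrho_\lambda(x,y,z)=(\lambda x,\lambda y,\lambda^2z)$ for $\lambda>0$, and $\mathbb{S}^{2n}_+=\{|x|^2+|y|^2+z^2=1,\ z>0\}$. Spherical caps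 $\Sigma\subset\mathbb{S}^{2n}_+$ are (open, nonempty) caps centered at the north pole $(0,0,1)$. The associated homogeneous cone is $C_\Sigma=\{\varrho_\lambda(p):\lambda>0,\ p\in\Sigma\}$, and $\alpha_\Sigma>0$ is the unique parameter such that $C_\Sigma=\{(x,y,z)\in\mathbb{R}^{2n+1}: |x|^2+|y|^2<\alpha_\Sigma z\}$ (for the full open hemisphere $\alpha_\Sigma=+\infty$ and the lower bound reads $0$). The full Hardy constant on $C_\Sigma$ is $$c_n(\Sigma)=\inf_{0\ne u\in C_c^\infty(C_\Sigma)}\frac{\int_{C_\Sigma}|\nabla_{\mathbb{H}}u|^2\,dp}{\int_{C_\Sigma}|u|^2\delta^{-2}\,dp}.$$ *)

(* Defs.v *)
From HB Require Import structures.
From mathcomp Require Import all_boot all_order all_algebra.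
From mathcomp Require Import all_classical all_reals all_analysis.
From mathcomp Require Import ring lra.

Set Implicit Arguments.
Unset Strict Implicit.
Unset Printing Implicit Defensive.

Import Order.TTheory GRing.Theory Num.Theory.
Import numFieldNormedType.Exports.

Local Open Scope classical_set_scope.
Local Open Scope ring_scope.

(** The canonical sigma-finite structure of the library on [m1 \x m2] is
    restricted to subprobabilities, hence this copy of [m1 \x m2]. *)
Section prod_measure.
Context d1 d2 (T1 : measurableType d1) (T2 : measurableType d2) (R : realType).
Variables (m1 : {sigma_finite_measure set T1 -> \bar R})
          (m2 : {sigma_finite_measure set T2 -> \bar R}).

Definition prod_measure : set (T1 * T2)%type -> \bar R := (m1 \x m2)%E.

HB.instance Definition _ := Measure.on prod_measure.

Let prod_measure_sigma_finite : sigma_finite setT prod_measure.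
Proof.
have /sigma_finiteP[F [TF ndF Foo]] := sigma_finiteT m1.
have /sigma_finiteP[G [TG ndG Goo]] := sigma_finiteT m2.
exists (fun k => F k `*` G k).
  rewrite -setXTT TF TG predeqE => -[x y]; split; last first.
    by move=> [k _ []/= ? ?]; split; exists k.
  move=> [/= [i _ Fix] [j _ Gjy]]; exists (maxn i j) => //; split.
  - by move: x Fix; exact/subsetPset/ndF/leq_maxl.
  - by move: y Gjy; exact/subsetPset/ndG/leq_maxr.
move=> k; have [mF Fk] := Foo k; have [mG Gk] := Goo k.
split; first exact: measurableX.
by rewrite /prod_measure product_measure1E// lte_mul_pinfty// ge0_fin_numE.
Qed.

HB.instance Definition _ := Measure_isSigmaFinite.Build _ _ _ prod_measure
  prod_measure_sigma_finite.

End prod_measure.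

(** As for [n.-tuple T] in the library, ['rV_n] carries the sigma-algebra
    generated by the coordinates (the Borel sigma-algebra of R^n). *)
Section rV_measurable.
Context {R : realType} (n : nat).

Let coord (i : 'I_n) (v : 'rV[R]_n) : R := v ord0 i.

Let rV_set0 : g_sigma_preimage coord set0.
Proof. exact: sigma_algebra0. Qed.

Let rV_setC A : g_sigma_preimage coord A -> g_sigma_preimage coord (~` A).
Proof. exact: sigma_algebraC. Qed.

Let rV_bigcup (F : (set 'rV[R]_n)^nat) :
  (forall i, g_sigma_preimage coord (F i)) ->
  g_sigma_preimage coord (\bigcup_i (F i)).
Proof. exact: sigma_algebra_bigcup. Qed.

HB.instance Definition _ :=
  @isMeasurable.Build default_measure_display 'rV[R]_n (g_sigma_preimage coord)
    rV_set0 rV_setC rV_bigcup.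

End rV_measurable.

Lemma measurable_rV_coord (R : realType) n (i : 'I_n) :
  measurable_fun [set: 'rV[R]_n] (fun v : 'rV[R]_n => v ord0 i).
Proof.
move=> _ Y mY; rewrite setTI; apply: sub_sigma_algebra => /=.
rewrite -bigcup_seq/=; exists i => /=; first by rewrite mem_index_enum.
by exists Y => //; rewrite setTI.
Qed.

Lemma measurable_fun_rV d (T : measurableType d) (R : realType) n
    (f : T -> 'rV[R]_n) :
  (forall i, measurable_fun [set: T] (fun x => f x ord0 i)) ->
  measurable_fun [set: T] f.
Proof.
move=> mf _ A mA; rewrite setTI.
have [sF sub] : sigma_algebra setT [set B | measurable (f @^-1` B)] /\
  \big[setU/set0]_(i < n) preimage_set_system [set: 'rV[R]_n]
     (fun v => v ord0 i) measurable `<=` [set B | measurable (f @^-1` B)].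
  split.
    split => /=.
    - by rewrite preimage_set0.
    - by move=> B mB; rewrite setTD preimage_setC; exact: measurableC.
    - by move=> F mF; rewrite preimage_bigcup; exact: bigcupT_measurable.
  rewrite -bigcup_seq => B [i _ [C mC <-]] /=.
  by rewrite setTI -comp_preimage -[X in measurable X]setTI; exact: mf.
exact: (smallest_sub sF sub mA).
Qed.

Section cons_measure.
Context {R : realType} {n : nat}.

Definition rV_cons (p : R * 'rV[R]_n) : 'rV[R]_n.+1 :=
  \row_j (if unlift ord0 j is Some i then p.2 ord0 i else p.1).

Lemma measurable_rV_cons : measurable_fun setT rV_cons.
Proof.
apply: measurable_fun_rV => j; rewrite /rV_cons.
case: (unliftP ord0 j) => [i|] ->.
- under eq_fun do rewrite mxE liftK.
  exact: (@measurableT_comp _ _ _ _ _ _ (fun v : 'rV[R]_n => v ord0 i) _ _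
            (measurable_rV_coord i) measurable_snd).
- under eq_fun do rewrite mxE unlift_none.
  exact: measurable_fst.
Qed.

Variable m : {sigma_finite_measure set 'rV[R]_n -> \bar R}.

(** The product of the 1-dimensional Lebesgue measure and [m], transported
    to ['rV_n.+1] *)
Definition cons_measure : set 'rV[R]_n.+1 -> \bar R :=
  pushforward (prod_measure lebesgue_measure m) rV_cons.

Let mpre A : measurable A -> measurable (rV_cons @^-1` A).
Proof.
by move=> mA; rewrite -[X in measurable X]setTI; exact: measurable_rV_cons.
Qed.

Let cons_measure0 : cons_measure set0 = 0%E.
Proof. by rewrite /cons_measure /pushforward preimage_set0 measure0. Qed.

Let cons_measure_ge0 A : (0 <= cons_measure A)%E.
Proof. by rewrite /cons_measure /pushforward; apply: measure_ge0. Qed.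

Let cons_measure_sigma_additive : semi_sigma_additive cons_measure.
Proof.
move=> F mF tF mUF; rewrite /cons_measure /pushforward preimage_bigcup.
apply: measure_semi_sigma_additive.
- by move=> k; exact: mpre.
- apply/trivIsetP => /= i j _ _ ij; rewrite -preimage_setI.
  by move/trivIsetP : tF => /(_ _ _ _ _ ij) ->//; rewrite preimage_set0.
- by rewrite -preimage_bigcup; exact: mpre.
Qed.

HB.instance Definition _ := isMeasure.Build _ _ _ cons_measure
  cons_measure0 cons_measure_ge0 cons_measure_sigma_additive.

Let cons_measure_sigma_finite : sigma_finite setT cons_measure.
Proof.
pose uncons (v : 'rV[R]_n.+1) := (v ord0 ord0, \row_i v ord0 (lift ord0 i)).
have consK : cancel rV_cons uncons.
  case=> t v; rewrite /uncons /rV_cons; congr pair.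
    by rewrite mxE unlift_none.
  by apply/rowP => i; rewrite !mxE liftK.
have munc : measurable_fun setT uncons.
  apply/measurable_fun_pairP; split.
    exact: (@measurable_rV_coord R n.+1 ord0).
  apply: measurable_fun_rV => i /=; under eq_fun do rewrite mxE.
  exact: measurable_rV_coord.
have [F TF Foo] := sigma_finiteT (prod_measure lebesgue_measure m).
exists (fun i => uncons @^-1` F i).
  by rewrite -preimage_bigcup -TF preimage_setT.
move=> i; have [mF Fi] := Foo i; split.
  by rewrite -[X in measurable X]setTI; exact: munc.
rewrite /cons_measure /pushforward -comp_preimage.
by rewrite (_ : uncons \o rV_cons = id)//; apply/funext => x /=; rewrite consK.
Qed.

HB.instance Definition _ := Measure_isSigmaFinite.Build _ _ _ cons_measure
  cons_measure_sigma_finite.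

End cons_measure.

Fixpoint lebesgue_rV (R : realType) (n : nat) :
    {sigma_finite_measure set 'rV[R]_n -> \bar R} :=
  match n with
  | 0 => dirac (0 : 'rV[R]_0)
  | n'.+1 => cons_measure (lebesgue_rV R n')
  end.

Lemma lebesgue_rV_box (R : realType) n (A : 'I_n -> set R) :
  (forall i, measurable (A i)) ->
  lebesgue_rV R n [set v | forall i, A i (v ord0 i)] =
  (\prod_(i < n) lebesgue_measure (A i))%E.
Proof.
elim: n A => [|n IHn] A mA /=.
  by rewrite big_ord0 diracE mem_set// => -[].
rewrite big_ord_recl -IHn; last by move=> i; exact: mA.
rewrite /cons_measure /pushforward /prod_measure.
have mB : measurable [set v : 'rV[R]_n | forall i, A (lift ord0 i) (v ord0 i)].
  rewrite (_ : mkset _ = \bigcap_(i in [set: 'I_n])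
      (fun v : 'rV[R]_n => v ord0 i) @^-1` (A (lift ord0 i))).
    apply: fin_bigcap_measurable => // i _; rewrite -[X in measurable X]setTI.
    exact: measurable_rV_coord.
  by apply/seteqP; split=> v /= Av i; [move=> _|]; exact: Av.
apply: etrans (product_measure1E lebesgue_measure (lebesgue_rV R n) (mA ord0) mB).
congr (product_measure1 _ _ _); apply/seteqP; split=> -[t v] /=.
  move=> Av; split; first by have := Av ord0; rewrite mxE unlift_none.
  by move=> i; have := Av (lift ord0 i); rewrite mxE liftK.
move=> [At Av] i; rewrite mxE.
by case: (unliftP ord0 i) => [j|] ->.
Qed.

Definition heis (R : realType) (n : nat) := ('rV[R]_n * 'rV[R]_n * R)%type.

Definition lebesgue_heis (R : realType) (n : nat) :
    {sigma_finite_measure set ('rV[R]_n * 'rV[R]_n * measurableTypeR R)%type -> \bar R} :=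
  prod_measure (prod_measure (lebesgue_rV R n) (lebesgue_rV R n))
    lebesgue_measure.

Section heisenberg.
Context {R : realType} {n : nat}.
Local Notation H := (heis R n).
Implicit Types (p v : H) (u : H -> R).

Definition sqnorm (x : 'rV[R]_n) : R := \sum_(i < n) x ord0 i ^+ 2.

(** Tangent vectors are identified with elements of [heis R n] by means of
    the global coordinates. *)
Definition Xfield (i : 'I_n) p : H :=
  (delta_mx ord0 i, 0, - (p.1.2 ord0 i / 2)).
Definition Yfield (i : 'I_n) p : H :=
  (0, delta_mx ord0 i, p.1.1 ord0 i / 2).

Definition frame_comb (a b : 'rV[R]_n) p : H :=
  \sum_(i < n) (a ord0 i *: Xfield i p + b ord0 i *: Yfield i p).

Definition horizontal p v := exists a b : 'rV[R]_n, v = frame_comb a b p.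

(** The frame is orthonormal, and the components of a horizontal vector in the
    frame are its first [2n] coordinates: see [hnorm_frame_comb]. *)
Definition hnorm v : R := Num.sqrt (sqnorm v.1.1 + sqnorm v.1.2).

Lemma frame_combE (a b : 'rV[R]_n) p :
  ((frame_comb a b p).1.1 = a) * ((frame_comb a b p).1.2 = b).
Proof.
have H1 : {morph (fun q : H => q.1.1) : q r / q + r} by [].
have H2 : {morph (fun q : H => q.1.2) : q r / q + r} by [].
rewrite /frame_comb (big_morph _ H1 (erefl _)) (big_morph _ H2 (erefl _)) /=.
split; rewrite [RHS]row_sum_delta; apply: eq_bigr => i _.
- by rewrite scaler0 addr0.
- by rewrite scaler0 add0r.
Qed.

Lemma hnorm_frame_comb (a b : 'rV[R]_n) p :
  hnorm (frame_comb a b p) =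
  Num.sqrt (\sum_(i < n) (a ord0 i ^+ 2 + b ord0 i ^+ 2)).
Proof. by rewrite /hnorm !frame_combE /sqnorm big_split. Qed.

Definition hgrad u p : H :=
  \sum_(i < n) ('D_(Xfield i p) u p *: Xfield i p
                + 'D_(Yfield i p) u p *: Yfield i p).

Definition abs_continuous (a b : R) (g : R -> H) :=
  forall e : R, 0 < e -> exists2 d : R, 0 < d &
    forall (k : nat) (s t : 'I_k -> R),
      (forall i, [/\ a <= s i, s i <= t i & t i <= b]) ->
      trivIset setT (fun i => `]s i, t i[%classic) ->
      \sum_(i < k) (t i - s i) < d ->
      \sum_(i < k) `|g (t i) - g (s i)| < e.

(** Only the values of the curves on [[0, 1]] matter. *)
Definition horizontal_curve (g : R -> H) :=
  abs_continuous 0 1 g /\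
  {ae lebesgue_measure, forall t : R, t \in `[0, 1] ->
     derivable g t 1 /\ horizontal (g t) (derive1 g t)}.

Definition curve_length (g : R -> H) : \bar R :=
  (\int[lebesgue_measure]_(t in `[0%R, 1%R]) (hnorm (derive1 g t))%:E)%E.

Definition cc_dist0 p : \bar R :=
  ereal_inf [set curve_length g |
             g in [set g | [/\ horizontal_curve g, g 0 = 0 & g 1 = p]]].

Definition smooth u :=
  forall (vs : seq H) p,
    differentiable (foldr (fun v (f : H -> R) => fun q => 'D_v f q) u vs) p.

Definition test_function (C : set H) u :=
  [/\ smooth u, compact (closure [set p | u p != 0]) &
      closure [set p | u p != 0] `<=` C].

Definition rayleigh (C : set H) u : \bar R :=
  (\int[lebesgue_heis R n]_(p in C) (hnorm (hgrad u p) ^+ 2)%:E /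
   \int[lebesgue_heis R n]_(p in C) ((`|u p| ^+ 2)%:E / cc_dist0 p ^+ 2))%E.

Definition hardy_constant (C : set H) : \bar R :=
  ereal_inf [set rayleigh C u |
             u in [set u | test_function C u /\ exists p, u p != 0]].

Definition upper_hemisphere : set H :=
  [set p | sqnorm p.1.1 + sqnorm p.1.2 + p.2 ^+ 2 = 1 /\ 0 < p.2].

(** Caps of the Euclidean sphere are cut out by half-spaces; [h] is the cosine
    of the opening angle. *)
Definition spherical_cap (S : set H) :=
  exists h : R, [/\ 0 <= h, h < 1 & S = upper_hemisphere `&` [set p | h < p.2]].

Definition dilation (l : R) p : H := (l *: p.1.1, l *: p.1.2, l ^+ 2 * p.2).

Definition cone (S : set H) : set H :=
  [set q | exists2 l : R, 0 < l & exists2 p, S p & q = dilation l p].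

(** For [a = +oo] this is the half-space [0 < z]. *)
Definition paraboloid (a : \bar R) : set H :=
  [set p | ((sqnorm p.1.1 + sqnorm p.1.2)%:E < a * (p.2)%:E)%E].

(** Well-defined on caps: see [cap_parameterP] and [cap_parameter_unique]. *)
Definition cap_parameter (S : set H) : \bar R :=
  get [set a : \bar R | (0 < a)%E /\ cone S = paraboloid a].

Lemma sqnorm_ge0 (x : 'rV[R]_n) : 0 <= sqnorm x.
Proof. by apply: sumr_ge0 => i _; exact: sqr_ge0. Qed.

Lemma sqnormZ (l : R) (x : 'rV[R]_n) : sqnorm (l *: x) = l ^+ 2 * sqnorm x.
Proof.
by rewrite /sqnorm mulr_sumr; apply: eq_bigr => i _; rewrite mxE exprMn.
Qed.

Let rho p := sqnorm p.1.1 + sqnorm p.1.2.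

Lemma dilation_to_sphere p : 0 < p.2 -> exists2 l : R, 0 < l &
  exists2 q, upper_hemisphere q & p = dilation l q.
Proof.
move=> z0; have r0 : 0 <= rho p by rewrite addr_ge0 ?sqnorm_ge0.
pose d := Num.sqrt (rho p ^+ 2 + 4 * p.2 ^+ 2).
have d2 : d ^+ 2 = rho p ^+ 2 + 4 * p.2 ^+ 2.
  by rewrite sqr_sqrtr// addr_ge0 ?sqr_ge0// mulr_ge0 ?sqr_ge0.
have rd : rho p < d.
  rewrite -(ltr_pXn2r (n := 2)) ?nnegrE ?sqrtr_ge0// d2 ltrDl.
  by rewrite mulr_gt0// exprn_gt0.
pose s := (d - rho p) / (2 * p.2 ^+ 2).
have s0 : 0 < s by rewrite divr_gt0 ?subr_gt0// mulr_gt0// exprn_gt0.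
have sE : rho p * s + p.2 ^+ 2 * s ^+ 2 = 1.
  have z2 : p.2 != 0 by rewrite gt_eqF.
  transitivity ((d ^+ 2 - rho p ^+ 2) / (4 * p.2 ^+ 2)).
    by rewrite /s; field.
  by rewrite d2; field.
have ls : Num.sqrt s ^+ 2 = s by rewrite sqr_sqrtr// ltW.
have l0 : 0 < Num.sqrt s by rewrite sqrtr_gt0.
exists (Num.sqrt s)^-1; first by rewrite invr_gt0.
exists (dilation (Num.sqrt s) p).
  split; last by rewrite /= ls mulr_gt0.
  rewrite /= !sqnormZ ls -mulrDr.
  by rewrite -[RHS]sE /rho; ring.
rewrite /dilation /= !scalerA mulrA -exprMn mulVf ?gt_eqF//.
by rewrite !scale1r expr1n mul1r; case: p {z0 r0 d d2 rd s s0 sE ls l0} => -[].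
Qed.

Lemma cone_capE (h : R) : 0 <= h ->
  cone (upper_hemisphere `&` [set p : H | h < p.2]) =
  [set p | 0 < p.2 /\ h * rho p < (1 - h ^+ 2) * p.2].
Proof.
move=> h0; apply/seteqP; split=> [_ [l l0 [q [[q1 qz] hq] ->]]|p [z0 hp]] /=.
  rewrite /= in hq; rewrite /rho /= !sqnormZ -mulrDr.
  split; first by rewrite mulr_gt0// exprn_gt0.
  rewrite mulrCA [ltRHS]mulrCA ltr_pM2l ?exprn_gt0//.
  have -> : sqnorm q.1.1 + sqnorm q.1.2 = 1 - q.2 ^+ 2 by rewrite -q1; ring.
  rewrite -subr_gt0.
  have -> : (1 - h ^+ 2) * q.2 - h * (1 - q.2 ^+ 2) = (q.2 - h) * (1 + h * q.2).
    by ring.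
  by rewrite mulr_gt0 ?subr_gt0// ltr_wpDr ?mulr_ge0// ltW.
have [l l0 [q [q1 qz] pE]] := dilation_to_sphere z0.
exists l => //; exists q => //; split=> //=.
move: hp; rewrite pE /rho /= !sqnormZ -mulrDr mulrCA [ltRHS]mulrCA.
rewrite ltr_pM2l ?exprn_gt0//.
have -> : sqnorm q.1.1 + sqnorm q.1.2 = 1 - q.2 ^+ 2 by rewrite -q1; ring.
rewrite -subr_gt0.
have -> : (1 - h ^+ 2) * q.2 - h * (1 - q.2 ^+ 2) = (q.2 - h) * (1 + h * q.2).
  by ring.
by rewrite pmulr_lgt0 ?subr_gt0// ltr_wpDr ?mulr_ge0// ltW.
Qed.

Lemma cap_parameter_ex (S : set H) : spherical_cap S ->
  exists a : \bar R, (0 < a)%E /\ cone S = paraboloid a.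
Proof.
case=> h [h0 h1 ->]; rewrite cone_capE//.
have rho_ge0 p : 0 <= rho p by rewrite addr_ge0 ?sqnorm_ge0.
have [->|hN0] := eqVneq h 0.
  exists +oo%E; split=> //; apply/seteqP; split=> p; rewrite /paraboloid /=.
    by case=> z0 _; rewrite gt0_mulye ?lte_fin// ltry.
  rewrite mul0r expr0n subr0 mul1r.
  have [z0|//|->] := ltgtP p.2 0.
    by rewrite lt0_mulye ?lte_fin.
  by rewrite mule0 lte_fin ltNge rho_ge0.
have hp : 0 < h by rewrite lt_neqAle eq_sym hN0.
have a0 : 0 < (1 - h ^+ 2) / h by rewrite divr_gt0// subr_gt0 expr_lt1.
exists ((1 - h ^+ 2) / h)%:E; rewrite lte_fin; split=> //.
apply/seteqP; split=> p; rewrite /paraboloid /= -EFinM lte_fin mulrAC ltr_pdivlMr//.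
  by case=> _; rewrite mulrC.
rewrite mulrC => hlt; split=> //.
rewrite -(pmulr_rgt0 _ (_ : 0 < 1 - h ^+ 2)) ?subr_gt0 ?expr_lt1//.
by apply: le_lt_trans hlt; rewrite mulr_ge0 ?rho_ge0.
Qed.

Lemma cap_parameterP (S : set H) : spherical_cap S ->
  (0 < cap_parameter S)%E /\ cone S = paraboloid (cap_parameter S).
Proof. by move=> /cap_parameter_ex capS; exact: (getPex capS). Qed.

Lemma cap_parameter_unique (S : set H) (a : \bar R) : (0 < n)%N ->
  spherical_cap S -> (0 < a)%E -> cone S = paraboloid a -> a = cap_parameter S.
Proof.
move=> n0 /cap_parameterP[]; move: (cap_parameter S) => b b0 -> a0 ab.
have ray (c : \bar R) (t : R) : 0 <= t ->
    paraboloid c ((Num.sqrt t *: delta_mx 0 (Ordinal n0), 0, 1) : H) <->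
    (t%:E < c)%E.
  move=> t0; rewrite /paraboloid /= mule1 sqnormZ sqr_sqrtr//.
  suff [-> ->] : sqnorm (delta_mx 0 (Ordinal n0) : 'rV[R]_n) = 1 /\
                 sqnorm (0 : 'rV[R]_n) = 0 by rewrite mulr1 addr0.
  split; last by apply: big1 => i _; rewrite mxE expr0n.
  rewrite /sqnorm (bigD1 (Ordinal n0))//= big1 => [|i iN0].
    by rewrite mxE !eqxx expr1n addr0.
  by rewrite mxE (negbTE iN0) andbF expr0n.
have half (c d : \bar R) : (0 < c)%E -> paraboloid c = paraboloid d :> set H ->
    (d <= c)%E.
  move=> c0 cd; rewrite leNgt; apply/negP.
  case: c c0 cd => [c|//|//] c0 cd cltd.
    have := (ray d c (ltW c0)).2 cltd; rewrite -cd.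
    by move/(ray _ _ (ltW c0)); rewrite ltxx.
  by move: cltd; rewrite ltNge leey.
by apply/eqP; rewrite eq_le !half.
Qed.

Definition cap_hardy_constant (S : set H) : \bar R := hardy_constant (cone S).

End heisenberg.

(* Main.v *)
Require Import Defs.
From HB Require Import structures.
From mathcomp Require Import all_boot all_order all_algebra.
From mathcomp Require Import all_classical all_reals all_analysis.
From mathcomp Require Import measurable_realfun ring lra.

(** On the cone [|x|^2 + |y|^2 < a z] the argument has two independent parts.

    Isoperimetry: every horizontal curve of length [L] from the origin ends at a
    height [z <= L^2 / (2 pi)], so [delta^2 >= 2 pi z].  With [s] the arclength
    and [w] the horizontal part of the curve, the function
    [z + L (L - s) / (4 th) - tan (th (s - L) / L) |w|^2 / 4] is nonincreasing
    along the curve for every [th < pi / 2]; compare its values at the endpoints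
    and let [th] tend to [pi / 2].

    Hardy inequality: the integral lines of [X_i] and [Y_i] are straight and meet
    the cone in segments, whose lengths [2 sqrt l] are functions of the point.
    The one-dimensional Poincare inequality on these segments, in the form of the
    pointwise identity [(Vu)^2 = pi^2/(4 l) u^2 + V(u^2 f) + (Vu - u f)^2] with [f]
    the logarithmic derivative of the first Dirichlet eigenfunction, integrates
    without boundary terms because the flow of [V] preserves the Lebesgue measure.
    Summing over [i] and using [1/l + 1/l' >= 4/(l + l')] bounds the energy below by
    a multiple of the integral of [u^2 / z]. *)

Set Implicit Arguments.
Unset Strict Implicit.
Unset Printing Implicit Defensive.

Import Order.TTheory GRing.Theory Num.Theory.
Import numFieldNormedType.Exports.

Local Open Scope classical_set_scope.
Local Open Scope ring_scope.

(** * Absolutely continuous functions *)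

(** The height gained by a horizontal curve is the sum of the signed areas swept in the planes
    [(x_i, y_i)], and [L^2 / (2 pi)] is Dido's half disc. The endpoint is free and no minimiser is
    ever constructed: the tangent [T] in the calibration solves the Riccati equation
    [T' = (th / L) (1 + T^2)] in the arclength, exactly what completing the square in the velocity
    asks for. At [th = pi / 2] the tangent would explode at the start of the curve, hence the
    smaller [th].

    Curves are only absolutely continuous, so the arclength is just an integral, derivatives exist
    almost everywhere, and monotonicity has to be deduced from a sign of the derivative off a null
    set.

    Constants: for each [i] the squared half-lengths of the two segments add up to at most
    [a (16 + a^2) z / 8], so [X_i] and [Y_i] together give the weight [8 pi^2 / (a (16 + a^2) z)];
    the [n] pairs and [1 / z >= 2 pi / delta^2] produce [16 pi^3 n / (a (16 + a^2))]. *)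

Section ac.
Context {R : realType}.
Local Notation mu := (@lebesgue_measure R).

(** Convertible to [abs_continuous 0 1] on [heis R n]; the general target lets curves, coordinates
    and arclength share one calculus. *)
Definition ac01 (V : normedModType R) (k : R -> V) :=
  forall e : R, 0 < e -> exists2 d : R, 0 < d &
    forall (n : nat) (s t : 'I_n -> R),
      (forall i, [/\ 0 <= s i, s i <= t i & t i <= 1]) ->
      trivIset setT (fun i => `]s i, t i[%classic) ->
      \sum_(i < n) (t i - s i) < d ->
      \sum_(i < n) `|k (t i) - k (s i)| < e.

Lemma sum_itv_mu n (s t : 'I_n -> R) : (forall i, s i <= t i) ->
  trivIset setT (fun i => `]s i, t i[%classic) ->
  mu (\big[setU/set0]_(i < n) `]s i, t i[%classic) =
  (\sum_(i < n) (t i - s i))%:E.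
Proof.
move=> st tI; rewrite measure_bigsetU_ord//.
rewrite -sumEFin; apply: eq_bigr => i _.
rewrite [LHS](lebesgue_measure_itv `]s i, t i[)/= lte_fin.
case: ltP => ti; rewrite ?EFinB//.
by congr EFin; apply/esym/eqP; rewrite subr_eq0 eq_le ti st.
Qed.

(** An increment across [t] splits at [t] into two difference quotients based at [t], each below
    [e]. *)
Lemma derive1_le0_near (k : R -> R) (t e : R) : 0 < e -> derivable k t 1 ->
  derive1 k t <= 0 -> exists2 r : R, 0 < r & forall a b, t - r < a -> a <= t ->
    t <= b -> b < t + r -> k b - k a <= e * (b - a).
Proof.
move=> e0 dk dk0.
have : (fun h => h^-1 *: (k (h + t) - k t)) @ 0^' --> derive1 k t.
  have : cvg ((fun h => h^-1 *: (k (h + t) - k t)) @ 0^').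
    move: dk; rewrite /derivable /=.
    by under eq_fun do rewrite scaler1.
  by [].
move=> /cvgrPdist_lt /(_ _ e0); rewrite near_withinE => /nbhs_ballP[r /= r0 rk].
have H h : `|h| < r -> h != 0 -> h^-1 * (k (h + t) - k t) < e.
  move=> hr h0; have := rk h; rewrite /ball/= sub0r normrN => /(_ hr h0).
  rewrite ltr_distlC => /andP[_]; rewrite /GRing.scale/= => /lt_le_trans; apply.
  by rewrite gerDr.
exists r => // a b ra at_ tb br.
have kb : k b - k t <= e * (b - t).
  move: tb; rewrite le_eqVlt => /predU1P[->|tb]; first by rewrite !subrr mulr0.
  have := H (b - t); rewrite subrK gtr0_norm ?subr_gt0// gt_eqF ?subr_gt0//.
  by rewrite ltrBlDl => /(_ br isT); rewrite mulrC ltr_pdivrMr ?subr_gt0// => /ltW.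
have ka : k t - k a <= e * (t - a).
  move: at_; rewrite le_eqVlt => /predU1P[->|at_]; first by rewrite !subrr mulr0.
  have := H (a - t); rewrite subrK ltr0_norm ?subr_lt0// lt_eqF ?subr_lt0//.
  rewrite opprB ltrBlDl -ltrBlDr => /(_ ra isT).
  by rewrite mulrC ltr_ndivrMr ?subr_lt0// => /ltW; rewrite -lerN2 opprB -mulrN opprB.
by have := lerD kb ka; rewrite -mulrDr !addrA !subrK.
Qed.

(** The exceptional set is covered by an open set [U] so small that the increments
    over disjoint intervals in [U] add up to at most [e]; outside of it the slope
    is locally at most [e]. Hence the property [P t] below propagates up to [1]. *)
Lemma ac_nonincreasing (k : R -> R) : ac01 (k : R -> R^o) ->
  {ae mu, forall t, t \in `[0%R, 1%R] -> derivable k t 1 /\ derive1 k t <= 0} ->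
  k 1 <= k 0.
Proof.
move=> ack [N [mN N0 subN]].
have dk (t : R) : 0 <= t <= 1 -> ~ N t -> derivable k t 1 /\ derive1 k t <= 0.
  move=> t01 Nt; apply: contrapT => Pt; apply: Nt; apply: subN => /=.
  by move=> /(_ _)/Pt; apply; rewrite in_itv/=.
suff E (e : R) : 0 < e -> k 1 - k 0 <= e *+ 2.
  rewrite -subr_le0; apply/ler_addgt0Pl => e e0; rewrite addr0.
  by rewrite [leRHS](splitr (e : R)) -mulr2n; apply: E; rewrite divr_gt0.
move=> e0.
have [d d0 kd] := ack _ e0.
have Noo : (mu N < +oo)%E by rewrite N0.
have [U [oU NU Ud]] := lebesgue_regularity_outer mN Noo d0.
(* Outer regularity bounds the measure of [U] minus [N]; adding back the null set [N] costs
   nothing. *)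
have {}Ud : (mu U < d%:E)%E.
  apply: le_lt_trans Ud.
  rewrite -[leRHS]addr0 -N0 -measureU//; last 2 first.
  - by apply: measurableD => //; exact: open_measurable.
  - by rewrite setDE -setIA setICl setI0.
  apply: le_measure; rewrite ?inE//.
  - exact: open_measurable.
  - by apply: measurableU => //; apply: measurableD => //; exact: open_measurable.
  - by rewrite setUC setDUK.
pose P (t : R) := [/\ 0 <= t, t <= 1 & exists n (s u : 'I_n -> R),
  [/\ forall i, [/\ 0 <= s i, s i <= u i, u i <= t & `]s i, u i[ `<=` U],
    trivIset setT (fun i => `]s i, u i[%classic) &
    k t - k 0 <= e * t + \sum_(i < n) `|k (u i) - k (s i)|]].
suff [_ _ [n [s [u [su tI]]]]] : P 1.
  rewrite mulr1 mulr2n => /le_trans; apply; rewrite lerD2l ltW//.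
  apply: kd => //; first by move=> i; have [? ? ? ?] := su i.
  rewrite -lte_fin -sum_itv_mu//; last by move=> i; have [? ? ? ?] := su i.
  apply: le_lt_trans Ud; apply: le_measure; rewrite ?inE.
  - exact: bigsetU_measurable.
  - exact: open_measurable.
  - by rewrite -bigcup_seq => x/= [i _]; have [_ _ _] := su i; apply.
have P0 : P 0.
  split=> //; exists 0%N, (fun=> 0), (fun=> 0); split.
  - by case.
  - by move=> [].
  - by rewrite subrr mulr0 big_ord0 addr0.
have hsP : has_sup P by split; [exists 0|exists 1 => t []].
pose tau := sup P.
have tau0 : 0 <= tau by apply: ub_le_sup => //; exact: hsP.2.
have tau1 : tau <= 1 by apply: ge_sup => [|t []//]; exists 0.
(* Near [tau], membership in [P] passes from any point on the left to any point on the right: [tau]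
   is reached, then exceeded unless it is 1. *)
have step : exists2 r : R, 0 < r & forall a b, tau - r < a -> a <= tau -> tau <= b ->
    b < tau + r -> b <= 1 -> P a -> P b.
  have [Nt|Nt] := pselect (N tau).
    (* If [tau] is exceptional, the interval from [a] to [b] lies in [U] and joins the family. *)
    have /nbhs_ballP[r /= r0 rU] : nbhs tau U by apply: open_nbhs_nbhs; split=> //; exact: NU.
    exists r => // a b ra at_ tb br b1 [a0 a1 [n [s [u [su tI kE]]]]].
    split=> //; first by rewrite (le_trans tau0).
    exists n.+1, (fun i => if unlift ord0 i is Some j then s j else a),
      (fun i => if unlift ord0 i is Some j then u j else b); split.
    - move=> i; case: unliftP => [j|] _.
        by have [? ? ua ?] := su j; split=> //; rewrite (le_trans ua)// (le_trans at_).
      split=> //; first exact: le_trans tb.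
      move=> x /=; rewrite in_itv/= => /andP[ax xb]; apply: rU.
      by rewrite /ball/= ltr_distlC (lt_trans ra)//= (lt_trans xb).
    - apply/trivIsetP => i j _ _.
      case: (unliftP ord0 i) => [i'|] ->; case: (unliftP ord0 j) => [j'|] -> //.
      + rewrite (inj_eq lift_inj) => ij.
        by move/trivIsetP : tI; exact.
      + move=> _; apply/seteqP; split=> x //= [].
        have [_ _ ua _] := su i'; rewrite !in_itv/= => /andP[_ xu] /andP[ax _].
        by have := lt_trans ax (lt_le_trans xu ua); rewrite ltxx.
      + move=> _; apply/seteqP; split=> x //= [].
        have [_ _ ua _] := su j'; rewrite !in_itv/= => /andP[ax _] /andP[_ xu].
        by have := lt_trans ax (lt_le_trans xu ua); rewrite ltxx.
    - rewrite big_ord_recl unlift_none.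
      under eq_bigr do rewrite liftK.
      have eab : e * a <= e * b by rewrite ler_pM2l// (le_trans at_).
      by have := ler_norm (k b - k a); move: kE eab; set S := \sum_(_ < _) _; lra.
  have [|dkt kt0] := dk tau _ Nt; first by rewrite tau0.
  have [r r0 rk] := derive1_le0_near e0 dkt kt0.
  exists r => // a b ra at_ tb br b1 [a0 a1 [n [s [u [su tI kE]]]]].
  split=> //; first by rewrite (le_trans tau0).
  exists n, s, u; split=> //.
    move=> i; have [? ? ua ?] := su i; split=> //.
    by rewrite (le_trans ua)// (le_trans at_).
  have -> : k b - k 0 = (k b - k a) + (k a - k 0) by rewrite addrA subrK.
  apply: (le_trans (lerD (rk _ _ ra at_ tb br) kE)).
  by rewrite addrA -mulrDr subrK.
have [r r0 rP] := step.
have [a Pa ra] := sup_adherent r0 hsP.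
have at_ : a <= tau by apply: ub_le_sup => //; exact: hsP.2.
have [tau_1|] := ltP tau 1; last first.
  by move=> t1; apply: (rP a) => //; rewrite (le_lt_trans t1)// ltrDl.
pose b := Num.min 1 (tau + r / 2).
have tb : tau < b by rewrite lt_min tau_1/= ltrDl divr_gt0.
suff /(ub_le_sup hsP.2) : P b by rewrite leNgt tb.
apply: (rP a) => //; first exact: ltW.
  rewrite gt_min; apply/orP; right; rewrite ltrD2l ltr_pdivrMr//.
  by rewrite ltr_pMr// ltr1n.
by rewrite ge_min lexx.
Qed.
End ac.

(** * Absolute continuity of the indefinite integral *)

Section integral_ac.

(** Truncate at height [n]: the integral of the excess [f n] tends to 0 by dominated convergence,
    and the rest contributes at most [n] times the measure of [A]. *)
Lemma integral_lt_small d (T : measurableType d) (R : realType)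
    (mu : {measure set T -> \bar R}) (m : T -> R) :
  mu.-integrable setT (EFin \o m) -> (forall x, 0 <= m x) ->
  forall e : R, 0 < e -> exists2 r : R, 0 < r & forall A, measurable A ->
    (mu A < r%:E -> \int[mu]_(x in A) (m x)%:E < e%:E)%E.
Proof.
move=> im m0 e e0; have /measurable_EFinP mm := measurable_int _ im.
pose f (n : nat) x := Num.max (m x - n%:R) 0.
have mf n : measurable_fun setT (f n).
  by apply: measurable_maxr => //; apply: measurable_funB.
have f0 n x : 0 <= f n x by rewrite le_max lexx orbT.
have fm n x : f n x <= m x by rewrite ge_max m0 andbT gerBl.
have fcvg x : (f n x)%:E @[n --> \oo] --> 0%E.
  apply: cvg_near_cst; near=> n; congr EFin; apply/max_idPr.
  rewrite subr_le0; near: n; exact: nbhs_infty_ger.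
have H : (\int[mu]_x (f n x)%:E)%E @[n --> \oo] --> (\int[mu]_x (cst 0 x))%E.
  apply: (@dominated_cvg _ _ _ mu setT measurableT (fun n => EFin \o f n) _
    (EFin \o m)) => //.
  - by move=> n; exact/measurable_EFinP.
  - by move=> x _; exact: fcvg.
  - by move=> n x _; rewrite /= lee_fin ger0_norm.
have {H} [n fe] : exists n, (\int[mu]_x (f n x)%:E < (e / 2)%:E)%E.
  apply: contrapT => /forallNP fe; suff : ((e / 2)%:E <= 0 :> \bar R)%E.
    by rewrite lee_fin leNgt divr_gt0.
  rewrite integral0 in H; apply: cvge_ge H; apply: nearW => n.
  by rewrite leNgt; apply/negP.
(* Dividing by [n.+1] also covers [n = 0]. *)
pose r := e / 2 / n.+1%:R.
exists r => [|A mA Ar]; first by rewrite !divr_gt0.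
have : (\int[mu]_(x in A) (m x)%:E <= \int[mu]_(x in A) ((f n x)%:E + (n%:R)%:E))%E.
  apply: ge0_le_integral => //.
  - by move=> x _; rewrite lee_fin.
  - exact/measurable_EFinP/measurable_funTS.
  - apply/measurable_EFinP/measurable_funD => //; exact: measurable_funTS.
  - by move=> x _; rewrite -EFinD lee_fin -lerBlDr le_max lexx.
move=> /le_lt_trans; apply.
rewrite ge0_integralD//; last 2 first.
- by move=> x _; rewrite lee_fin.
- exact/measurable_EFinP/measurable_funTS.
rewrite integral_cst// [e in ltRHS]splitr EFinD.
apply: lte_leD => //.
- by rewrite fin_numM// ge0_fin_numE// (lt_trans Ar)// ltry.
- apply: le_lt_trans fe; apply: ge0_subset_integral => //.
    exact/measurable_EFinP.
  by move=> x _; rewrite lee_fin.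
- rewrite (le_trans (lee_wpmul2l _ (ltW Ar)))// -EFinM lee_fin /r.
  rewrite mulrCA ler_piMr//; first by rewrite divr_ge0// ltW.
  by rewrite ler_pdivrMr// mul1r ler_nat.
Unshelve. all: by end_near.
Qed.

Lemma ac01_integral (R : realType) (m : R -> R) :
  lebesgue_measure.-integrable setT (EFin \o m) -> (forall x, 0 <= m x) ->
  ac01 ((fun x => \int[lebesgue_measure]_(t in `[0, x]) m t) : R -> R^o).
Proof.
move=> im m0 e e0.
have [r r0 Hr] := integral_lt_small im m0 e0.
exists r => // n s t st tI str.
pose F i := `]s i, t i[%classic : set R.
have mF i : measurable (F i) by exact: measurable_itv.
have : (\int[lebesgue_measure]_(x in \big[setU/set0]_(i < n) F i) (m x)%:E < e%:E)%E.
  apply: Hr.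
    by apply: bigsetU_measurable => i _; exact: mF.
  rewrite [ltLHS](_ : _ = (\sum_(i < n) (t i - s i))%:E) ?lte_fin//.
  by apply: sum_itv_mu => // i; have [] := st i.
rewrite ge0_integral_bigsetU//; last 4 first.
- exact: index_enum_uniq.
- by apply: sub_trivIset tI.
- by apply: measurable_funTS; exact: measurable_int im.
- by move=> x _; rewrite lee_fin.
move=> H; rewrite -lte_fin; apply: le_lt_trans H.
rewrite -sumEFin; apply: lee_sum => i _.
have [si sti ti] := st i.
have imS A : measurable A -> lebesgue_measure.-integrable A (EFin \o m).
  by move=> mA; exact: integrableS im.
rewrite Rintegral_itvB; [|exact: imS|by rewrite bnd_simp|by rewrite bnd_simp].
rewrite -Rintegral_itv_bndo_bndc; last exact: imS.
rewrite ger0_norm; last by apply: Rintegral_ge0.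
by rewrite /Rintegral fineK//; apply: integrable_fin_num => //; exact: imS.
Qed.
End integral_ac.

(** * Calculus of absolutely continuous functions *)

Section ac_calculus.
Context {R : realType}.

(** Common source of the stability under sums, products and Lipschitz maps. The sign of [C] is free,
    whence [|C| + 1] in the proof. *)
Lemma ac01_dom (V1 V2 V3 : normedModType R) (k : R -> V1) (f : R -> V2)
    (g : R -> V3) (C : R) :
  (forall s t, 0 <= s -> s <= t -> t <= 1 ->
    `|k t - k s| <= C * (`|f t - f s| + `|g t - g s|)) ->
  ac01 f -> ac01 g -> ac01 k.
Proof.
move=> kfg acf acg e e0.
have C0 : 0 < 2 * (`|C| + 1) by rewrite mulr_gt0// ltr_wpDl.
have [d1 d10 H1] := acf (e / (2 * (`|C| + 1))) (divr_gt0 e0 C0).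
have [d2 d20 H2] := acg (e / (2 * (`|C| + 1))) (divr_gt0 e0 C0).
exists (Num.min d1 d2) => [|n s t st tI]; first by rewrite lt_min d10.
rewrite lt_min => /andP[/(H1 _ _ _ st tI) + /(H2 _ _ _ st tI)].
set A := \sum_(_ < _) _; set B := \sum_(_ < _) _ => A1 B1.
have : (`|C| + 1) * (A + B) < e.
  have : (A + B) < e / (`|C| + 1).
    have -> : e / (`|C| + 1) = e / (2 * (`|C| + 1)) + e / (2 * (`|C| + 1)).
      by field; rewrite gt_eqF// ltr_wpDl.
    exact: ltrD.
  by rewrite ltr_pdivlMr ?ltr_wpDl// mulrC.
apply: le_lt_trans; rewrite /A /B -big_split/= mulr_sumr.
apply: ler_sum => i _; have [s0 st' t1] := st i.
rewrite (le_trans (kfg _ _ s0 st' t1))// ler_wpM2r ?addr_ge0//.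
by rewrite (le_trans (ler_norm _))// lerDl.
Qed.

Lemma ac01_cst (V : normedModType R) (c : V) : ac01 (fun _ : R => c).
Proof.
move=> e e0; exists 1 => // n s t _ _ _; rewrite big1// => i _.
by rewrite subrr normr0.
Qed.

Lemma ac01_lip (V1 V2 : normedModType R) (k : R -> V1) (f : R -> V2) (C : R) :
  (forall s t, 0 <= s -> s <= t -> t <= 1 -> `|k t - k s| <= C * `|f t - f s|) ->
  ac01 f -> ac01 k.
Proof.
move=> kf acf.
apply: (@ac01_dom _ _ R^o k f (cst 0) C) acf (ac01_cst _) => s t s0 st t1.
by rewrite subrr normr0 addr0 kf.
Qed.

Lemma ac01_unif (V : normedModType R) (f : R -> V) : ac01 f ->
  forall e : R, 0 < e -> exists2 d : R, 0 < d & forall s t, 0 <= s -> s <= t ->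
    t <= 1 -> t - s < d -> `|f t - f s| < e.
Proof.
move=> acf e /acf[d d0 H]; exists d => // s t s0 st t1 tsd.
have := H 1%N (fun=> s) (fun=> t); rewrite !big_ord1; apply => //.
by apply/trivIsetP => i j _ _; rewrite !ord1 eqxx.
Qed.

(** Continues a function on [0, 1] by its endpoint values: [ac01] constrains it only there, while
    continuity and difference quotients involve a neighbourhood. *)
Definition clamp01 (t : R) : R := Num.max 0 (Num.min 1 t).

Lemma clamp01_in t : 0 <= clamp01 t <= 1.
Proof.
by rewrite /clamp01 le_max lexx /= ge_max ler01 ge_min lexx.
Qed.

Lemma clamp01_id t : 0 <= t <= 1 -> clamp01 t = t.
Proof. by case/andP=> t0 t1; rewrite /clamp01 (min_idPr t1) (max_idPr t0). Qed.

Lemma clamp01_lip s t : s <= t -> clamp01 s <= clamp01 t <= clamp01 s + (t - s).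
Proof.
move=> st; rewrite /clamp01 /Num.max /Num.min.
by repeat case: ifPn; rewrite -?leNgt; lra.
Qed.

Lemma ac01_clamp_continuous (V : normedModType R) (f : R -> V) : ac01 f ->
  continuous (f \o clamp01).
Proof.
move=> acf t; apply/cvgrPdist_lt => e e0.
have [d d0 H] := ac01_unif acf e0.
near=> s; rewrite /=.
have std : `|t - s| < d by near: s; apply: cvgr_dist_lt.
have [st|ts] := leP s t.
  have /andP[c1 c2] := clamp01_lip st.
  have /andP[s0 s1] := clamp01_in s; have /andP[t0 t1] := clamp01_in t.
  apply: H => //; move: std; rewrite ger0_norm ?subr_ge0//; lra.
have /andP[c1 c2] := clamp01_lip (ltW ts).
have /andP[s0 s1] := clamp01_in s; have /andP[t0 t1] := clamp01_in t.
rewrite distrC; apply: H => //; move: std; rewrite distrC gtr0_norm ?subr_gt0//; lra.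
Unshelve. all: by end_near. Qed.

Lemma ac01_bounded (f : R -> R) : ac01 (f : R -> R^o) ->
  exists2 M : R, 0 <= M & forall t, 0 <= t -> t <= 1 -> `|f t| <= M.
Proof.
move=> acf; have cf := ac01_clamp_continuous acf.
have cn : {within `[0, 1], continuous (fun t => `|f (clamp01 t)|)}.
  apply: continuous_subspaceT => t; apply: continuous_comp; first exact: cf.
  exact: norm_continuous.
have [c _ H] := EVT_max ler01 cn.
exists `|f (clamp01 c)| => // t t0 t1; have := H t.
by rewrite clamp01_id ?t0//; apply; rewrite in_itv/= t0.
Qed.

Lemma ac01D (f g : R -> R) : ac01 (f : R -> R^o) -> ac01 (g : R -> R^o) ->
  ac01 ((fun t => f t + g t) : R -> R^o).
Proof.
move=> acf acg; apply: (ac01_dom (C := 1)) acf acg => s t _ _ _.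
by rewrite mul1r opprD addrACA ler_normD.
Qed.

Lemma ac01M (f g : R -> R) : ac01 (f : R -> R^o) -> ac01 (g : R -> R^o) ->
  ac01 ((fun t => f t * g t) : R -> R^o).
Proof.
move=> acf acg; have [M M0 fM] := ac01_bounded acf; have [N N0 gN] := ac01_bounded acg.
apply: (ac01_dom (C := M + N)) acf acg => s t s0 st t1.
have -> : f t * g t - f s * g s = f t * (g t - g s) + (f t - f s) * g s by ring.
rewrite (le_trans (ler_normD _ _))// !normrM mulrDr !mulrDl.
have tf : `|f t| * `|g t - g s| <= M * `|g t - g s|.
  by rewrite ler_wpM2r// fM// (le_trans s0).
have sg : `|f t - f s| * `|g s| <= N * `|f t - f s|.
  by rewrite mulrC ler_wpM2r// gN// (le_trans st).
have : 0 <= M * `|f t - f s| by rewrite mulr_ge0.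
have : 0 <= N * `|g t - g s| by rewrite mulr_ge0.
lra.
Qed.

Lemma ac01_sum n (f : 'I_n -> R -> R) : (forall i, ac01 (f i : R -> R^o)) ->
  ac01 ((fun t => \sum_(i < n) f i t) : R -> R^o).
Proof.
elim: n f => [|n IH] f acf.
  have -> : (fun t => \sum_(i < 0) f i t) = cst 0.
    by apply/funext => t; rewrite big_ord0.
  exact: ac01_cst.
have -> : (fun t => \sum_(i < n.+1) f i t) =
    (fun t => f ord0 t + \sum_(i < n) f (lift ord0 i) t).
  by apply/funext => t; rewrite big_ord_recl.
by apply: ac01D; [exact: acf|apply: IH => i; exact: acf].
Qed.
End ac_calculus.

(** * The isoperimetric inequality *)

Section isoperimetry.
Context {R : realType}.

(** Mean value theorem with [cos >= cos th > 0] on [[- th, th]]. This makes the tangent of the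
    rescaled arclength absolutely continuous. *)
Lemma tan_lipschitz (th u v : R) : th < pi / 2 -> - th <= u -> u <= v -> v <= th ->
  `|tan v - tan u| <= cos th ^- 2 * `|v - u|.
Proof.
move=> thpi thu uv vth.
have cosge w : - th <= w -> w <= th -> 0 < cos th <= cos w.
  move=> w1 w2; have th0 : 0 <= th by lra.
  rewrite cos_gt0_pihalf ?thpi/=; last by have := @pi_gt0 R; lra.
  have wth : `|w| <= th by rewrite ler_norml w1.
  rewrite -(cos_norm w) leNgt ltr_cos ?in_itv/= -?leNgt//.
    by rewrite th0; have := @pi_gt0 R; lra.
  by rewrite normr_ge0 (le_trans wth)//; have := @pi_gt0 R; lra.
have cosw w : w \in `[u, v] -> 0 < cos th <= cos w.
  by rewrite in_itv/= => /andP[w1 w2]; apply: cosge; lra.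
have [||c cuv ->] := @MVT_segment R tan (fun x => cos x ^- 2) u v uv.
- move=> x /subset_itv_oo_cc /cosw /andP[c0 c1]; apply: is_derive_tan.
  by rewrite gt_eqF// (lt_le_trans c0).
- apply: derivable_within_continuous => x /cosw /andP[c0 c1].
  apply: ex_derive; apply: is_derive_tan.
  by rewrite gt_eqF// (lt_le_trans c0).
have /andP[c0 c1] := cosw _ cuv.
rewrite normrM ler_wpM2r// ger0_norm ?invr_ge0 ?sqr_ge0//.
have c2 : 0 < cos c := lt_le_trans c0 c1.
rewrite lef_pV2 ?posrE ?exprn_gt0//.
by rewrite lerXn2r ?nnegrE//; exact: ltW.
Qed.

(** [T] stands for [tan (th (s - L) / L)] and [sd] for the speed; the proof is
    [2 q v <= c q^2 + v^2 / c] with [c = 2 th sd / L]. *)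
Lemma calibration_le (n : nat) (x y A B : 'I_n -> R) (T sd th L : R) :
  0 < th -> 0 < L -> 0 <= sd ->
  \sum_(i < n) (A i ^+ 2 + B i ^+ 2) <= sd ^+ 2 ->
  \sum_(i < n) (x i * B i - y i * A i) / 2 -
  T / 2 * \sum_(i < n) (x i * A i + y i * B i) <=
  sd * (L / (4 * th) + th / (4 * L) * (1 + T ^+ 2) * \sum_(i < n) (x i ^+ 2 + y i ^+ 2)).
Proof.
move=> th0 L0 sd0 ABsd.
pose c := 2 * th * sd / L.
pose q1 i := (x i - T * y i) / 2; pose q2 i := (- y i - T * x i) / 2.
(* The left side is linear in the velocity, with [q1^2 + q2^2 = (1 + T^2) (x^2 + y^2) / 4] for each
   index. *)
have -> : \sum_(i < n) (x i * B i - y i * A i) / 2 -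
  T / 2 * \sum_(i < n) (x i * A i + y i * B i) = \sum_(i < n) (q1 i * B i + q2 i * A i).
  by rewrite mulr_sumr -sumrB; apply: eq_bigr => i _; rewrite /q1 /q2; field.
(* At zero speed [c] vanishes and cannot be divided by; then all velocities vanish and both sides
   are 0. *)
move: sd0; rewrite le_eqVlt => /predU1P[sd0|sd0].
  rewrite -sd0 mul0r big1// => i _.
  have : A i ^+ 2 + B i ^+ 2 <= 0.
    rewrite (le_trans _ (le_trans ABsd _))//; last by rewrite -sd0 expr0n.
    rewrite (bigD1 i)//= lerDl sumr_ge0// => j _.
    by rewrite addr_ge0 ?sqr_ge0.
  rewrite real_leNgt ?num_real// -real_leNgt ?num_real// => H.
  have A0 : A i = 0 by apply/eqP; rewrite -sqrf_eq0 eq_le sqr_ge0 andbT; have := sqr_ge0 (B i); lra.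
  have B0 : B i = 0 by apply/eqP; rewrite -sqrf_eq0 eq_le sqr_ge0 andbT; have := sqr_ge0 (A i); lra.
  by rewrite A0 B0 !mulr0 addr0.
have c0 : 0 < c by rewrite divr_gt0// !mulr_gt0.
have -> : sd * (L / (4 * th) + th / (4 * L) * (1 + T ^+ 2) * \sum_(i < n) (x i ^+ 2 + y i ^+ 2)) =
  \sum_(i < n) (c / 2 * (q1 i ^+ 2 + q2 i ^+ 2)) + sd ^+ 2 / (2 * c).
  rewrite mulrDr addrC; congr (_ + _); last by rewrite /c; field; rewrite !gt_eqF.
  rewrite mulrA mulr_sumr; apply: eq_bigr => i _; rewrite /q1 /q2 /c; field.
  by rewrite gt_eqF.
apply: (@le_trans _ _ (\sum_(i < n) (c / 2 * (q1 i ^+ 2 + q2 i ^+ 2)) +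
   (\sum_(i < n) (A i ^+ 2 + B i ^+ 2)) / (2 * c))); last first.
  by rewrite lerD2l ler_wpM2r// invr_ge0 mulr_ge0// ltW.
rewrite mulr_suml -big_split/=; apply: ler_sum => i _.
rewrite -subr_ge0.
have -> : c / 2 * (q1 i ^+ 2 + q2 i ^+ 2) + (A i ^+ 2 + B i ^+ 2) / (2 * c) -
  (q1 i * B i + q2 i * A i) = ((c * q1 i - B i) ^+ 2 + (c * q2 i - A i) ^+ 2) / (2 * c).
  by field; rewrite gt_eqF.
by rewrite divr_ge0 ?addr_ge0 ?sqr_ge0// mulr_ge0// ltW.
Qed.

(** The calibration [k] starts at [L^2 / (4 th)], because [s] and [W] vanish there, and ends at or
    above [z 1], because [s 1 <= L] and the tangent is nonpositive. In between, [tan' = 1 + tan^2]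
    turns [calibration_le] into the sign of the derivative of [k]. *)
Lemma isoperimetric_theta (n : nat) (x y : 'I_n -> R -> R) (z s : R -> R) (th L : R) :
  0 < th -> th < pi / 2 -> 0 < L ->
  (forall i, ac01 (x i : R -> R^o)) -> (forall i, ac01 (y i : R -> R^o)) ->
  ac01 (z : R -> R^o) -> ac01 (s : R -> R^o) ->
  (forall i, x i 0 = 0) -> (forall i, y i 0 = 0) -> z 0 = 0 -> s 0 = 0 ->
  (forall t, 0 <= t -> t <= 1 -> 0 <= s t <= L) ->
  {ae lebesgue_measure, forall t : R, t \in `[0, 1] -> exists A B sd,
    [/\ forall i, is_derive t 1 (x i) (A i), forall i, is_derive t 1 (y i) (B i),
      is_derive t 1 z (\sum_(i < n) (x i t * B i - y i t * A i) / 2),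
      is_derive t 1 s sd & 0 <= sd /\ \sum_(i < n) (A i ^+ 2 + B i ^+ 2) <= sd ^+ 2]} ->
  z 1 <= L ^+ 2 / (4 * th).
Proof.
move=> th0 thpi L0 acx acy acz acs x0 y0 z0 s0 sL der.
pose v t := th / L * (s t - L).
have vth t : 0 <= t -> t <= 1 -> - th <= v t <= 0.
  move=> t0 t1; have /andP[s1 s2] := sL _ t0 t1; rewrite /v.
  rewrite mulr_ge0_le0 ?subr_le0 ?divr_ge0 ?(ltW th0) ?(ltW L0)// andbT.
  rewrite mulrBr mulfVK ?gt_eqF// lerDr mulr_ge0// divr_ge0// ltW//.
pose W t := \sum_(i < n) (x i t * x i t + y i t * y i t).
pose k t := z t + (L / (4 * th) * (L - s t) + (- 4^-1) * (tan (v t) * W t)).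
have acv : ac01 ((fun t => tan (v t)) : R -> R^o).
  apply: (ac01_lip (C := cos th ^- 2 * (th / L))) acs => a b a0 ab b1.
  have va := vth _ a0 (le_trans ab b1); have vb := vth _ (le_trans a0 ab) b1.
  have -> : cos th ^- 2 * (th / L) * `|s b - s a| = cos th ^- 2 * `|v b - v a|.
    have -> : v b - v a = th / L * (s b - s a) by rewrite /v; ring.
    by rewrite normrM (@ger0_norm _ (th / L)) ?mulrA// divr_ge0// ltW.
  have [vab|/ltW vab] := leP (v a) (v b).
    by apply: tan_lipschitz => //; lra.
  by rewrite distrC (distrC (v b)); apply: tan_lipschitz => //; lra.
have ack : ac01 (k : R -> R^o).
  apply: ac01D => //; apply: ac01D; apply: ac01M; try exact: ac01_cst.
    apply: (ac01_lip (C := 1)) acs => a b _ _ _.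
    rewrite mul1r distrC le_eqVlt; apply/orP; left; apply/eqP.
    by congr (`|_|); ring.
  apply: ac01M => //; apply: ac01_sum => i; apply: ac01D; exact: ac01M.
have := ac_nonincreasing ack.
have -> : k 0 = L ^+ 2 / (4 * th).
  rewrite /k z0 s0 /W big1 => [|i _]; last by rewrite x0 y0 !mulr0 addr0.
  by rewrite !mulr0 addr0 add0r subr0 expr2 mulrAC.
move=> H; apply: le_trans (H _).
  rewrite /k lerDl addr_ge0//.
    rewrite mulr_ge0//; first by rewrite divr_ge0 ?mulr_ge0// ltW.
    rewrite subr_ge0.
    by have /andP[] := sL 1 ler01 (lexx _).
  rewrite mulNr oppr_ge0 mulr_ge0_le0// mulr_le0_ge0//; last first.
    by apply: sumr_ge0 => i _; rewrite -!expr2 addr_ge0 ?sqr_ge0.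
  have /andP[v1 v2] := vth 1 ler01 (lexx _).
  have v3 : - pi / 2 < v 1 by lra.
  rewrite /tan -oppr_ge0 -mulNr -sinN divr_ge0//.
    apply: sin_ge0_pi; have := @pi_gt0 R; lra.
  by rewrite ltW// cos_gt0_pihalf//; have := @pi_gt0 R; lra.
apply: (@filterS _ _ (ae_filter_ringOfSetsType _)) der => t' Ht t01.
move: (Ht t01) (t01) => {Ht t01}; move: (t' : R) => t [A [B [sd [dx dy dz ds [sd0 ABsd]]]]] t01.
move: t01; rewrite in_itv/= => /andP[t0 t1].
have /andP[v1 v2] := vth t t0 t1.
have cosv : cos (v t) != 0.
  by rewrite gt_eqF// cos_gt0_pihalf//; have := @pi_gt0 R; lra.
have dW : is_derive t 1 W (\sum_(i < n) (2 * (x i t * A i + y i t * B i))).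
  have -> : W = \sum_(i < n) (x i * x i + y i * y i)%R.
    by apply/funext => u; rewrite /W fct_sumE.
  apply: is_derive_eq (is_derive_sum (fun i => is_deriveD
    (is_deriveM (dx i) (dx i)) (is_deriveM (dy i) (dy i)))) _.
  by apply: eq_bigr => i _; rewrite /GRing.scale/=; ring.
have dv : is_derive t 1 v (th / L * sd).
  apply: is_derive_eq (is_deriveM (is_derive_cst (th / L) t 1)
    (is_deriveB ds (is_derive_cst L t 1))) _.
  by rewrite /GRing.scale/=; ring.
have dtan : is_derive t 1 (fun t => tan (v t)) (th / L * sd * cos (v t) ^- 2).
  apply: is_derive_eq (is_derive1_comp (is_derive_tan cosv) dv) _.
  by rewrite mulrC.
have dk : is_derive t 1 k (\sum_(i < n) (x i t * B i - y i t * A i) / 2 +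
  (L / (4 * th) * (- sd) + (- 4^-1) * (tan (v t) * \sum_(i < n) (2 * (x i t * A i + y i t * B i)) +
    W t * (th / L * sd * cos (v t) ^- 2)))).
  have D := (is_deriveD dz (is_deriveD
    (is_deriveM (is_derive_cst (L / (4 * th)) t 1)
      (is_deriveB (is_derive_cst L t 1) ds))
    (is_deriveM (is_derive_cst (- 4^-1 : R) t 1) (is_deriveM dtan dW)))).
  apply: is_derive_eq D _.
  by rewrite /GRing.scale/=; ring.
split; first exact: ex_derive.
rewrite derive1E derive_val.
have := calibration_le (x^~ t) (y^~ t) (tan (v t)) th0 L0 sd0 ABsd.
rewrite -mulr_sumr -(cos2_tan2 cosv).
set S := \sum_(i < n) (x i t * B i - _) / 2.
set Q := \sum_(i < n) (x i t * A i + _).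
have -> : \sum_(i < n) (x i t ^+ 2 + y i t ^+ 2) = W t.
  by apply: eq_bigr => i _; rewrite !expr2.
set c := cos _ ^- 2; set T := tan _; rewrite -subr_ge0 => calib.
rewrite -oppr_ge0; apply: le_trans calib _.
rewrite le_eqVlt; apply/orP; left; apply/eqP; field.
by rewrite !gt_eqF.
Qed.

(** The limit in [th] takes the form of a contradiction: if [s 1 < S], there is room for a length
    [L] between [s 1] and [S] and for an angle with [L^2 / (4 z 1) < th < pi / 2], which
    [isoperimetric_theta] forbids. Choosing [L > s 1] also secures [0 < L]. *)
Lemma isoperimetric (n : nat) (x y : 'I_n -> R -> R) (z s : R -> R) :
  (forall i, ac01 (x i : R -> R^o)) -> (forall i, ac01 (y i : R -> R^o)) ->
  ac01 (z : R -> R^o) -> ac01 (s : R -> R^o) ->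
  (forall i, x i 0 = 0) -> (forall i, y i 0 = 0) -> z 0 = 0 -> s 0 = 0 ->
  (forall t, 0 <= t -> t <= 1 -> 0 <= s t <= s 1) ->
  {ae lebesgue_measure, forall t : R, t \in `[0, 1] -> exists A B sd,
    [/\ forall i, is_derive t 1 (x i) (A i), forall i, is_derive t 1 (y i) (B i),
      is_derive t 1 z (\sum_(i < n) (x i t * B i - y i t * A i) / 2),
      is_derive t 1 s sd & 0 <= sd /\ \sum_(i < n) (A i ^+ 2 + B i ^+ 2) <= sd ^+ 2]} ->
  2 * pi * z 1 <= s 1 ^+ 2.
Proof.
move=> acx acy acz acs x0 y0 z0 s0 sL der.
have s1 : 0 <= s 1 by have /andP[] := sL 1 ler01 (lexx _).
have [z1|z1] := leP (z 1) 0.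
  by rewrite (le_trans (mulr_ge0_le0 _ z1)) ?sqr_ge0// mulr_ge0// pi_ge0.
rewrite leNgt; apply/negP => sz.
pose S := Num.sqrt (2 * pi * z 1).
have S2 : S ^+ 2 = 2 * pi * z 1 by rewrite sqr_sqrtr// !mulr_ge0 ?pi_ge0// ltW.
have sS : s 1 < S.
  by rewrite -(ltr_pXn2r (n := 2)) ?nnegrE ?sqrtr_ge0// S2.
pose L := (s 1 + S) / 2.
have sL1 : s 1 < L by rewrite /L; lra.
have LS : L < S by rewrite /L; lra.
have L0 : 0 < L by exact: le_lt_trans sL1.
have L2 : L ^+ 2 / (4 * z 1) < pi / 2.
  rewrite ltr_pdivrMr ?mulr_gt0//.
  have -> : pi / 2 * (4 * z 1) = S ^+ 2 by rewrite S2; field.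
  by rewrite ltr_pXn2r// ?nnegrE ?ltW// (lt_trans L0).
have L20 : 0 < L ^+ 2 / (4 * z 1) by apply: divr_gt0; [exact: exprn_gt0|exact: mulr_gt0].
pose th := (L ^+ 2 / (4 * z 1) + pi / 2) / 2.
have th0 : 0 < th by rewrite /th; lra.
have thpi : th < pi / 2 by rewrite /th; lra.
have thL : L ^+ 2 / (4 * z 1) < th by rewrite /th; lra.
clearbody th.
have sL' t : 0 <= t -> t <= 1 -> 0 <= s t <= L.
  by move=> t0 t1; have /andP[-> /le_trans->//] := sL _ t0 t1; exact: ltW.
have := isoperimetric_theta th0 thpi L0 acx acy acz acs x0 y0 z0 s0 sL' der.
rewrite leNgt => /negP; apply.
rewrite ltr_pdivrMr ?mulr_gt0//; move: thL; rewrite ltr_pdivrMr ?mulr_gt0//.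
by have -> : th * (4 * z 1) = z 1 * (4 * th) by ring.
Qed.

End isoperimetry.

(** * Coordinates of horizontal curves *)

Section curves.
Context {R : realType} {n : nat}.
Local Notation H := (heis R n).

(** Linearity of [c] is stated in the shape of a difference quotient, so that [c] passes inside it
    before the limit is taken. *)
Lemma is_derive_linear_comp (V : normedModType R) (c : V -> R) (g : R -> V) (t : R) :
  continuous c -> (forall a u v, c (a *: (u - v)) = a * (c u - c v)) ->
  derivable g t 1 -> is_derive t 1 (c \o g) (c (derive1 g t)).
Proof.
move=> cc cl dg.
have dg' : (fun h => h^-1 *: ((g \o shift t) (h *: (1 : R)) - g t)) @ 0^' --> derive1 g t.
  by rewrite derive1E.
have dcg : (fun h => h^-1 *: (((c \o g) \o shift t) (h *: (1 : R)) - (c \o g) t)) @ 0^' -->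
    c (derive1 g t).
  have -> : (fun h => h^-1 *: (((c \o g) \o shift t) (h *: (1 : R)) - (c \o g) t)) =
     c \o (fun h => h^-1 *: ((g \o shift t) (h *: (1 : R)) - g t)).
    by apply/funext => h /=; rewrite cl.
  by apply: continuous_cvg dg'; exact: cc.
apply: DeriveDef; first by apply/cvg_ex; exists (c (derive1 g t)).
by rewrite /derive; exact: cvg_lim.
Qed.

Lemma fst_cont (T U : topologicalType) : continuous (fst : T * U -> T).
Proof. by move=> p; exact: cvg_fst. Qed.

Lemma snd_cont (T U : topologicalType) : continuous (snd : T * U -> U).
Proof. by move=> p; exact: cvg_snd. Qed.

Lemma continuous_xcoord (i : 'I_n) : continuous (fun p : H => p.1.1 ord0 i).
Proof.
move=> p; have H1 := @fst_cont _ _ p; have H2 := @fst_cont _ _ p.1.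
have H3 := @coord_continuous R 1 n ord0 i p.1.1.
exact: (continuous_comp (continuous_comp H1 H2) H3).
Qed.

Lemma continuous_ycoord (i : 'I_n) : continuous (fun p : H => p.1.2 ord0 i).
Proof.
move=> p; have H1 := @fst_cont _ _ p; have H2 := @snd_cont _ _ p.1.
have H3 := @coord_continuous R 1 n ord0 i p.1.2.
exact: (continuous_comp (continuous_comp H1 H2) H3).
Qed.

Lemma continuous_zcoord : continuous (fun p : H => p.2).
Proof. by move=> p; exact: cvg_snd. Qed.

(** Turns horizontality into the equation for [z] that [isoperimetric] requires. *)
Lemma frame_comb_z (a b : 'rV[R]_n) (p : H) : (frame_comb a b p).2 =
  \sum_(i < n) (p.1.1 ord0 i * b ord0 i - p.1.2 ord0 i * a ord0 i) / 2.
Proof.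
have H2 : {morph (fun q : H => q.2) : q r / q + r} by [].
rewrite /frame_comb (big_morph _ H2 (erefl _)) /=; apply: eq_bigr => i _.
by rewrite /GRing.scale/=; field.
Qed.

Lemma rV_coord_norm (v : 'rV[R]_n) (i : 'I_n) : `|v ord0 i| <= `|v|.
Proof.
rewrite [leRHS]mx_normrE.
exact: (@le_bigmax _ _ _ 0 (fun ij => `|v ij.1 ij.2|) (ord0, i)).
Qed.

Lemma xcoord_norm (i : 'I_n) (p : H) : `|p.1.1 ord0 i| <= `|p|.
Proof.
apply: (le_trans (rV_coord_norm _ _)).
by rewrite !prod_normE !le_max lexx.
Qed.

Lemma ycoord_norm (i : 'I_n) (p : H) : `|p.1.2 ord0 i| <= `|p|.
Proof.
apply: (le_trans (rV_coord_norm _ _)).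
by rewrite !prod_normE !le_max lexx orbT.
Qed.

Lemma zcoord_norm (p : H) : `|p.2| <= `|p|.
Proof. by rewrite prod_normE le_max lexx orbT. Qed.

Lemma ac01_coord (c : H -> R) (g : R -> H) : (forall p q, c (p - q) = c p - c q) ->
  (forall p, `|c p| <= `|p|) -> ac01 g -> ac01 ((c \o g) : R -> R^o).
Proof.
move=> cB cn; apply: (ac01_lip (C := 1)) => s t _ _ _.
by rewrite mul1r /= -cB.
Qed.
End curves.

Section integral_monotone.
Import HBNNSimple.

(** The integral of a nonnegative function is a supremum over the simple functions below it, so the
    comparison holds for arbitrary functions. It serves for integrands built on [cc_dist0] or on
    default values of [derive1]. *)
Lemma ge0_le_integralT d (T : measurableType d) (R : realType)
    (mu : {measure set T -> \bar R}) (f g : T -> \bar R) :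
  (forall x, 0 <= f x)%E -> (forall x, f x <= g x)%E ->
  (\int[mu]_x f x <= \int[mu]_x g x)%E.
Proof.
move=> f0 fg; have g0 x : (0 <= g x)%E by exact: le_trans (fg x).
rewrite !ge0_integralTE//.
apply: ereal_sup_le => _ [h hf <-]; exists h => // x.
exact: le_trans (fg x).
Qed.

End integral_monotone.

(** Lets a derivative be read along the sequence [1 / (k + 1)], for measurability of limits and for
    dominated convergence. *)
Lemma cvg_harmonic_dnbhs (R : realType) : (@harmonic R) @ \oo --> 0^'.
Proof.
move=> A A0.
have H : \forall k \near \oo, @harmonic R k != 0 -> A (@harmonic R k).
  exact: (@cvg_harmonic R _ A0).
apply: (@filterS _ \oo _ _ _ _ H) => k; apply.
by rewrite gt_eqF// harmonic_gt0.
Qed.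

(** * Lower bound for the Carnot-Caratheodory distance *)

Section curve_length.
Context {R : realType} {n : nat}.
Local Notation H := (heis R n).
Local Notation mu := (@lebesgue_measure R).

(** Pointwise limit of difference quotients of the clamped curve; as [D] lies in the open unit
    interval, the clamping is invisible for small increments. *)
Lemma measurable_derive1_coord (c : H -> R) (g : R -> H) (D : set R) :
  continuous c -> (forall a u v, c (a *: (u - v)) = a * (c u - c v)) ->
  ac01 g -> measurable D ->
  (forall t, D t -> [/\ 0 < t, t < 1 & derivable g t 1]) ->
  measurable_fun D (fun t => c (derive1 g t)).
Proof.
move=> cc cl acg mD HD.
pose h t := c (g (clamp01 t)).
have ch : continuous h.
  move=> t; apply: continuous_comp; last exact: cc.
  exact: ac01_clamp_continuous.
pose f (k : nat) t := k.+1%:R * (h (t + k.+1%:R^-1) - h t).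
apply: (@measurable_fun_cvg _ _ _ D f).
  move=> k; apply: measurable_funTS.
  have mh : measurable_fun [set: R] h by exact: continuous_measurable_fun.
  apply: measurable_funM; first exact: measurable_cst.
  apply: measurable_funB => //; apply: measurableT_comp => //.
  exact: measurable_funD.
move=> t /HD[t0 t1 dg].
have [dcg dE] := is_derive_linear_comp cc cl dg.
rewrite -dE /derive.
have /cvg_ex[l Hl] := dcg.
rewrite (cvg_lim _ Hl)//.
have := cvg_comp _ _ (@cvg_harmonic_dnbhs R) Hl.
apply: cvg_trans; apply: near_eq_cvg; near=> k.
rewrite /f /h /= invrK /GRing.scale/= mulr1 (addrC _ t).
have tk : t + k.+1%:R^-1 <= 1.
  rewrite -lerBrDl ltW//; near: k.
  by apply: (cvgr_lt 0 cvg_harmonic); rewrite subr_gt0.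
rewrite !clamp01_id//; first by rewrite !ltW.
by rewrite tk addr_ge0// ltW.
Unshelve. all: by end_near. Qed.

(** The arclength given to [isoperimetric] is the integral of the speed cut off outside the set [D]
    of good times: elsewhere [derive1] may be a default value. *)
Lemma curve_length_ge (g : R -> H) : horizontal_curve g -> g 0 = 0 ->
  0 < (g 1).2 -> ((Num.sqrt (2 * pi * (g 1).2))%:E <= curve_length g)%E.
Proof.
move=> [acg [N [mN N0 subN]]] g0 z1.
pose D : set R := `]0%R, 1%R[%classic `\` N.
have mD : measurable D by apply: measurableD.
have HD t : D t -> [/\ 0 < t, t < 1, derivable g t 1 & horizontal (g t) (derive1 g t)].
  rewrite /D/= in_itv/= => -[/andP[t0 t1] Nt].
  suff [? ?] : derivable g t 1 /\ horizontal (g t) (derive1 g t) by [].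
  apply: contrapT => Pt; apply: Nt; apply: subN => /= /(_ _)/Pt; apply.
  by rewrite in_itv/= !ltW.
(* Infinite length satisfies any lower bound; finite length makes the cut-off speed integrable. *)
have [oo|fin] := eqVneq (curve_length g) +oo%E; first by rewrite oo leey.
pose speed t := hnorm (derive1 g t).
have speed0 t : 0 <= speed t by exact: sqrtr_ge0.
have mx (c : H -> R) : continuous c -> (forall a u v, c (a *: (u - v)) = a * (c u - c v)) ->
    measurable_fun D (fun t => c (derive1 g t)).
  by move=> cc cl; apply: measurable_derive1_coord => // t /HD[].
have mspeed : measurable_fun D speed.
  apply: (@measurableT_comp _ _ _ _ _ _ (@Num.sqrt R)).
    exact: (continuous_measurable_fun (@sqrt_continuous R)).
  apply: measurable_funD; apply: measurable_sum => i; apply: measurable_funX.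
    apply: (mx (fun p => p.1.1 ord0 i)); first exact: continuous_xcoord.
    by move=> a u v; rewrite !mxE.
  apply: (mx (fun p => p.1.2 ord0 i)); first exact: continuous_ycoord.
  by move=> a u v; rewrite !mxE.
pose m : R -> R := speed \_ D.
have m0 t : 0 <= m t by rewrite /m patchE; case: ifP.
have mm : measurable_fun setT m by exact: ((measurable_restrictT speed mD).1 mspeed).
have ml : (\int[mu]_t (m t)%:E <= curve_length g)%E.
  rewrite /curve_length [leRHS]integral_mkcond.
  apply: ge0_le_integralT => t; first by rewrite lee_fin.
  rewrite /m !patchE; case: ifPn => [|_].
    rewrite inE /D/= in_itv/= => -[/andP[t0 t1] _].
    by rewrite mem_set//= in_itv/= !ltW.
  by case: ifP => _; [rewrite lee_fin; exact: speed0|exact: lexx].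
have im : mu.-integrable setT (EFin \o m).
  apply/integrableP; split; first exact/measurable_EFinP.
  under eq_integral => t _ do rewrite /= ger0_norm//.
  by rewrite (le_lt_trans ml)// lt_neqAle fin leey.
pose s (x : R) := \int[mu]_(t in `[0, x]) m t.
have acs : ac01 (s : R -> R^o) by exact: ac01_integral.
have imS A : measurable A -> mu.-integrable A (EFin \o m).
  by move=> mA; exact: integrableS im.
have s1 : ((s 1)%:E <= curve_length g)%E.
  apply: le_trans ml; rewrite /s /Rintegral fineK; last first.
    by apply: integrable_fin_num => //; exact: imS.
  apply: ge0_subset_integral => //; first exact/measurable_EFinP.
  by move=> x _; rewrite lee_fin.
have s_mono a b : 0 <= a -> a <= b -> s a <= s b.
  move=> a0 ab; rewrite -subr_ge0 /s Rintegral_itvB ?bnd_simp//.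
  - exact: Rintegral_ge0.
  - exact: imS.
have s0 : s 0 = 0 by rewrite /s set_itv1 Rintegral_set1.
apply: le_trans s1; rewrite lee_fin.
have sge0 : 0 <= s 1 by rewrite -s0; exact: s_mono.
rewrite -[leRHS]ger0_norm// -sqrtr_sqr; apply: ler_wsqrtr.
apply: (isoperimetric (n := n) (x := fun i t => (g t).1.1 ord0 i)
  (y := fun i t => (g t).1.2 ord0 i) (z := fun t => (g t).2)) => //.
- move=> i; apply: (ac01_coord (c := fun p : H => p.1.1 ord0 i)) acg => [p q|p].
    by rewrite !mxE.
  exact: xcoord_norm.
- move=> i; apply: (ac01_coord (c := fun p : H => p.1.2 ord0 i)) acg => [p q|p].
    by rewrite !mxE.
  exact: ycoord_norm.
- apply: (ac01_coord (c := fun p : H => p.2)) acg => [p q|p] //.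
  exact: zcoord_norm.
- by move=> i; rewrite g0 mxE.
- by move=> i; rewrite g0 mxE.
- by rewrite g0.
- by move=> t t0 t1; rewrite -{1}s0 !s_mono.
(* Lebesgue differentiation gives [s' = m] off a null set [M]; the endpoints are discarded too,
   since [D] excludes them. *)
have [M [mM M0 subM]] := @FTC1 R m (BLeft 0) (fun y => imS _ (measurable_itv _))
   (open_integrable_locally openT im).
have m01 : measurable ([set 0; 1] : set R).
  by apply: measurableU; exact: measurable_set1.
have mNM : measurable (N `|` M) by exact: measurableU.
exists (N `|` M `|` [set 0; 1]); split.
- exact: measurableU.
- apply: null_set_setU => //; first exact: null_set_setU.
  by apply: countable_lebesgue_measure0; exact: finite_set_countable.
move=> t /=; apply: contra_notP => /not_orP[/not_orP[Nt Mt] /not_orP[t0 t1]].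
rewrite in_itv/= => /andP[t0' t1'].
have Dt : D t.
  split=> //=; rewrite in_itv/= !lt_neqAle t0' t1' !andbT.
  by apply/andP; split; apply/eqP => //; exact: nesym.
have [t0lt t1lt dg [a [b ab]]] := HD _ Dt.
have [ds sE] : derivable s t 1 /\ derive1 s t = m t.
  apply: contrapT => Ps; apply: Mt; apply: subM => /=.
  by move=> /(_ _)/Ps; apply; rewrite lte_fin.
exists (fun i => a ord0 i), (fun i => b ord0 i), (m t).
have a_ : (derive1 g t).1.1 = a by rewrite ab frame_combE.
have b_ : (derive1 g t).1.2 = b by rewrite ab frame_combE.
split.
- move=> i; rewrite -a_.
  apply: (is_derive_linear_comp (c := fun p : H => p.1.1 ord0 i)) => //.
    exact: continuous_xcoord.
  by move=> ? ? ?; rewrite !mxE.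
- move=> i; rewrite -b_.
  apply: (is_derive_linear_comp (c := fun p : H => p.1.2 ord0 i)) => //.
    exact: continuous_ycoord.
  by move=> ? ? ?; rewrite !mxE.
- rewrite -frame_comb_z -ab.
  by apply: (is_derive_linear_comp (c := fun p : H => p.2)) => //; exact: continuous_zcoord.
- by rewrite -sE derive1E; exact: derivableP.
split=> //; rewrite /m patchE mem_set// /speed /hnorm sqr_sqrtr; last first.
  by rewrite addr_ge0 ?sqnorm_ge0.
by rewrite a_ b_ big_split.
Qed.

Lemma cc_dist0_ge (p : H) : 0 < p.2 -> ((Num.sqrt (2 * pi * p.2))%:E <= cc_dist0 p)%E.
Proof.
move=> p0; apply: le_ereal_inf_tmp => _ [g [hg g0 g1] <-].
by rewrite -g1; apply: curve_length_ge => //; rewrite g1.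
Qed.
End curve_length.

(** * Lebesgue measure on the Heisenberg group *)

Section heis_borel.
Context {R : realType} {n : nat}.
Local Notation H := (heis R n).
Local Notation T := ('rV[R]_n * 'rV[R]_n * measurableTypeR R)%type.

Lemma heis_norm_leP (v : H) (e : R) : 0 <= e ->
  `|v| <= e <-> [/\ forall i, `|v.1.1 ord0 i| <= e, forall i, `|v.1.2 ord0 i| <= e & `|v.2| <= e].
Proof.
have rV_le (w : 'rV[R]_n) : 0 <= e -> `|w| <= e <-> forall i, `|w ord0 i| <= e.
  move=> e0; split => [we i|we]; first exact: le_trans (rV_coord_norm _ _) we.
  by rewrite [leLHS]mx_normrE; apply: bigmax_le => // -[i j] _ /=; rewrite ord1.
move=> e0; rewrite !prod_normE !ge_max; split.
  by move=> /andP[/andP[/rV_le H1 /rV_le H2] ?]; split=> //; [exact: H1|exact: H2].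
by case=> H1 H2 ->; rewrite andbT; apply/andP; split; apply/rV_le.
Qed.

(** Closed ball of the maximum norm, hence a product of intervals. *)
Definition cube (p : H) (e : R) : set H := [set q | `|q - p| <= e].

Lemma measurable_rV_box (A : 'I_n -> set R) : (forall i, measurable (A i)) ->
  measurable [set v : 'rV[R]_n | forall i, A i (v ord0 i)].
Proof.
move=> mA; rewrite (_ : mkset _ = \bigcap_(i in [set: 'I_n])
    (fun v : 'rV[R]_n => v ord0 i) @^-1` (A i)).
  apply: fin_bigcap_measurable => // i _; rewrite -[X in measurable X]setTI.
  exact: measurable_rV_coord.
by apply/seteqP; split=> v /= Av i; [move=> _|]; exact: Av.
Qed.

Lemma measurable_rV_cube (w : 'rV[R]_n) (e : R) : measurable
  [set v : 'rV[R]_n | forall i, `[w ord0 i - e, w ord0 i + e]%classic (v ord0 i)].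
Proof.
apply: (measurable_rV_box (A := fun i => `[w ord0 i - e, w ord0 i + e]%classic)).
by move=> i; exact: measurable_itv.
Qed.

Lemma cubeE (p : H) (e : R) : 0 <= e -> cube p e =
  [set v : 'rV[R]_n | forall i, `[p.1.1 ord0 i - e, p.1.1 ord0 i + e]%classic (v ord0 i)] `*`
  [set v : 'rV[R]_n | forall i, `[p.1.2 ord0 i - e, p.1.2 ord0 i + e]%classic (v ord0 i)] `*`
  `[p.2 - e, p.2 + e]%classic.
Proof.
move=> e0; apply/seteqP; split=> q /=.
  move/(heis_norm_leP _ e0) => [H1 H2]; rewrite /= ler_distl => H3.
  split; last by rewrite in_itv.
  by split => i; rewrite in_itv/= -ler_distl; [have := H1 i|have := H2 i]; rewrite !mxE.
case=> [[H1 H2]]; rewrite in_itv/= -ler_distl => H3.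
apply/(heis_norm_leP _ e0); split=> //= i; rewrite !mxE ler_distl.
  by have := H1 i; rewrite in_itv.
by have := H2 i; rewrite in_itv.
Qed.

Lemma measurable_cube (p : H) (e : R) : 0 <= e -> measurable (cube p e : set T).
Proof.
move=> e0; rewrite cubeE//; apply: measurableX; last exact: measurable_itv.
by apply: measurableX; exact: measurable_rV_cube.
Qed.

(** Finiteness makes bounded functions with bounded support integrable; positivity bounds integrals
    from below. *)
Lemma lebesgue_cube (p : H) (e : R) : 0 < e ->
  exists2 r : R, 0 < r & lebesgue_heis R n (cube p e) = r%:E.
Proof.
move=> e0; rewrite cubeE ?ltW//.
have mI (a : R) : measurable (`[a - e, a + e]%classic : set R) by exact: measurable_itv.
have lI (a : R) : lebesgue_measure (`[a - e, a + e]%classic : set R) = (e *+ 2)%:E.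
  rewrite lebesgue_measure_itv/= lte_fin ltrBlDr -addrA ltrDl addr_gt0//.
  by rewrite -EFinB; congr EFin; rewrite mulr2n; ring.
have lrV (w : 'rV[R]_n) :
    lebesgue_rV R n
      [set v : 'rV[R]_n | forall i, `[w ord0 i - e, w ord0 i + e]%classic (v ord0 i)] =
    ((e *+ 2) ^+ n)%:E.
  rewrite (lebesgue_rV_box (A := fun i => `[w ord0 i - e, w ord0 i + e]%classic))//.
  under eq_bigr do rewrite lI.
  by rewrite prodEFin prodr_const card_ord.
exists ((e *+ 2) ^+ n * (e *+ 2) ^+ n * (e *+ 2)).
  by rewrite !mulr_gt0 ?exprn_gt0// pmulrn_lgt0.
have mX := measurable_rV_cube p.1.1 e; have mY := measurable_rV_cube p.1.2 e.
apply: etrans (product_measure1E (prod_measure (lebesgue_rV R n) (lebesgue_rV R n))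
  lebesgue_measure (measurableX mX mY) (mI p.2)) _.
rewrite EFinM; congr (_ * _)%E; last exact: lI.
apply: etrans (product_measure1E (lebesgue_rV R n) (lebesgue_rV R n) mX mY) _.
by rewrite EFinM; congr (_ * _)%E; exact: lrV.
Qed.

(** Links the topology to the sigma-algebra generated by the coordinates: an open set is the union
    of the countably many cubes inside it with radius [1 / (k + 1)] and centre on the grid of that
    mesh. Rounding the coordinates of [p] down gives a cube containing [p]. *)
Lemma open_measurable_heis (U : set H) : open U -> measurable (U : set T).
Proof.
move=> oU.
pose Q (k : 'rV[int]_n * 'rV[int]_n * int * nat) : H :=
  (\row_i ((k.1.1.1 ord0 i)%:~R / k.2.+1%:R),
   \row_i ((k.1.1.2 ord0 i)%:~R / k.2.+1%:R), k.1.2%:~R / k.2.+1%:R).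
pose F k := if `[< cube (Q k) k.2.+1%:R^-1 `<=` U >] then cube (Q k) k.2.+1%:R^-1 else set0.
have -> : U = \bigcup_k F k.
  apply/seteqP; split=> [p Up|p [k _]]; last first.
    by rewrite /F; case: asboolP => // + ?; apply.
  have /nbhs_normP[e /= e0 eU] : nbhs p U by exact: open_nbhs_nbhs.
  have [k kP] : exists k : nat, 2 * k.+1%:R^-1 < e.
    have [k _ /(_ _ (leqnn k)) ek] := @nbhs_infty_gtr R (2 / e).
    exists k; rewrite ltr_pdivrMr// mulrC -ltr_pdivrMr//.
    by rewrite (lt_trans ek)// ltr_nat.
  have rdist (x : R) : `|x - (Num.floor (x * k.+1%:R))%:~R / k.+1%:R| <= k.+1%:R^-1.
    have k0 : (0 : R) < k.+1%:R by [].
    have /andP[f1 f2] := floor_itv (x * k.+1%:R); move: f2; rewrite intrD => f2.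
    set fl : R := _%:~R in f1 f2 *.
    have -> : x - fl / k.+1%:R = (x * k.+1%:R - fl) / k.+1%:R.
      by rewrite mulrBl mulfK ?gt_eqF.
    rewrite normrM normfV (@ger0_norm _ k.+1%:R)// ler_piMl ?invr_ge0//.
    by rewrite ger0_norm ?subr_ge0// lerBlDl ltW// addrC.
  pose m : 'rV[int]_n * 'rV[int]_n * int * nat :=
    (\row_i Num.floor (p.1.1 ord0 i * k.+1%:R), \row_i Num.floor (p.1.2 ord0 i * k.+1%:R),
     Num.floor (p.2 * k.+1%:R), k).
  have pm : cube (Q m) k.+1%:R^-1 p.
    apply/heis_norm_leP; first by rewrite invr_ge0.
    by split=> [i|i|]; rewrite /= ?mxE.
  exists m => //; rewrite /F; case: asboolP => // -[] q qm.
  apply: eU => /=; apply: le_lt_trans kP.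
  have -> : p - q = (p - Q m) + (Q m - q) by rewrite addrA subrK.
  by rewrite mulr_natl mulr2n (le_trans (ler_normD _ _))// lerD// distrC.
apply: countable_bigcupT_measurable => // k; rewrite /F; case: ifP => // _.
by apply: measurable_cube; rewrite invr_ge0.
Qed.

Lemma continuous_measurable_heis (f : H -> R) : continuous f ->
  measurable_fun (setT : set T) (f : T -> R).
Proof.
move=> cf; apply: (measurability _ (RGenOInfty.measurableE R)) => _ [_ [x ->] <-].
rewrite setTI; apply: open_measurable_heis.
by apply: open_comp; [move=> p _; exact: cf|rewrite set_itvoy; exact: open_gt].
Qed.

End heis_borel.

(** * Measure-preserving maps and the flows of the fields *)

Section measure_preserving.
Context {R : realType}.

Definition measure_preserving d (T : measurableType d)
    (m : {measure set T -> \bar R}) (f : T -> T) :=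
  measurable_fun setT f /\ forall A, measurable A -> m (f @^-1` A) = m A.

Lemma measure_preserving_id d (T : measurableType d) (m : {measure set T -> \bar R}) :
  measure_preserving m id.
Proof. by split. Qed.

Lemma ge0_integral_measure_preserving d (T : measurableType d)
    (m : {measure set T -> \bar R}) (f : T -> T) (g : T -> \bar R) :
  measure_preserving m f -> measurable_fun setT g -> (forall x, 0 <= g x)%E ->
  (\int[m]_x g (f x) = \int[m]_x g x)%E.
Proof.
move=> [mf pf] mg g0.
have := @ge0_integral_pushforward _ _ _ _ _ f mf m setT g measurableT mg (fun x _ => g0 x).
rewrite preimage_setT => <-.
pose m' : {measure set T -> \bar R} :=
  measure_function_pushforward__canonical__measure_function_Measure m mf.
by apply: (@eq_measure_integral _ _ _ _ m m') => A mA _; exact: pf.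
Qed.

Lemma integral_measure_preserving d (T : measurableType d)
    (m : {measure set T -> \bar R}) (f : T -> T) (g : T -> \bar R) :
  measure_preserving m f -> measurable_fun setT g ->
  (\int[m]_x g (f x) = \int[m]_x g x)%E.
Proof.
move=> mpf mg; rewrite integralE [in RHS]integralE.
congr (_ - _)%E.
- rewrite -(ge0_integral_measure_preserving mpf (measurable_funepos mg) (funepos_ge0 g)).
  by apply: eq_integral => x _; rewrite !funeposE.
- rewrite -(ge0_integral_measure_preserving mpf (measurable_funeneg mg) (funeneg_ge0 g)).
  by apply: eq_integral => x _; rewrite !funenegE.
Qed.

(** The section at [x] of the preimage of [A] is the preimage under [h x] of the section of [A] at
    [f x]; integrate the measures of the sections. *)
Lemma measure_preserving_skew d1 d2 (T1 : measurableType d1) (T2 : measurableType d2)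
    (m1 : {sigma_finite_measure set T1 -> \bar R})
    (m2 : {sigma_finite_measure set T2 -> \bar R}) (f : T1 -> T1) (h : T1 -> T2 -> T2) :
  measure_preserving m1 f -> (forall x, measure_preserving m2 (h x)) ->
  measurable_fun setT (fun p : T1 * T2 => (f p.1, h p.1 p.2)) ->
  measure_preserving (prod_measure m1 m2) (fun p : T1 * T2 => (f p.1, h p.1 p.2)).
Proof.
move=> pf ph mfh; split=> // A mA.
have mphi := measurable_fun_xsection m2 mA.
apply: etrans (ge0_integral_measure_preserving pf mphi (fun x => measure_ge0 m2 _)).
apply: eq_integral => x _ /=.
rewrite -((ph x).2 _ (measurable_xsection (f x) mA)).
congr (m2 _); apply/seteqP; split=> y /=; rewrite /xsection /= !inE//.
Qed.

Lemma measure_preserving_shift (c : R) :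
  measure_preserving (@lebesgue_measure R) (fun x => x + c).
Proof.
have ms : measurable_fun [set: measurableTypeR R]
    ((fun x => x + c) : measurableTypeR R -> measurableTypeR R).
  exact: measurable_funD.
split=> // A mA; apply/esym.
pose m' : {measure set (measurableTypeR R) -> \bar R} :=
  measure_function_pushforward__canonical__measure_function_Measure (@lebesgue_measure R) ms.
apply: (@lebesgue_measure_unique R m') => // X [[a b] _ <-].
rewrite /m'/= /pushforward.
have -> : (fun x => x + c) @^-1` `]a, b] = `]a - c, b - c]%classic.
  by apply/seteqP; split=> x /=; rewrite !in_itv/= ltrBlDr lerBrDr.
rewrite !lebesgue_measure_itv/= !lte_fin ltrD2r -!EFinD opprD opprK.
by case: ifP => // _; congr EFin; ring.
Qed.

(** Induction along [lebesgue_rV]: through [rV_cons] the translation moves either the head or the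
    tail, so it is a skew product. *)
Lemma measure_preserving_rV (n : nat) (i : 'I_n) (c : R) :
  measure_preserving (lebesgue_rV R n) (fun v => v + c *: delta_mx ord0 i).
Proof.
have mf k (j : 'I_k) : measurable_fun setT (fun v : 'rV[R]_k => v + c *: delta_mx ord0 j).
  apply: measurable_fun_rV => l; under eq_fun do rewrite !mxE.
  apply: measurable_funD; last exact: measurable_cst.
  exact: measurable_rV_coord.
elim: n i => [[]//|n IH] i; split=> [|A mA]; first exact: mf.
rewrite /= /cons_measure /pushforward.
have mA' : measurable (@rV_cons R n @^-1` A).
  by rewrite -[X in measurable X]setTI; exact: measurable_rV_cons.
rewrite -comp_preimage.
have [j|] := unliftP ord0 i => ->.
  have -> : (fun v => v + c *: delta_mx ord0 (lift ord0 j)) \o @rV_cons R n =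
    @rV_cons R n \o (fun p => (p.1, p.2 + c *: delta_mx ord0 j)).
    apply/funext => p; apply/rowP => k /=; rewrite !mxE.
    case: unliftP => [k'|] ->; first by rewrite !mxE (inj_eq lift_inj).
    by rewrite eqxx/= mulr0 addr0.
  rewrite comp_preimage.
  have msk : measurable_fun setT
      (fun p : R * 'rV[R]_n => (p.1, p.2 + c *: delta_mx ord0 j)).
    apply/measurable_fun_pairP; split; first exact: measurable_fst.
    exact: measurableT_comp (mf _ j) measurable_snd.
  exact: (measure_preserving_skew (measure_preserving_id (@lebesgue_measure R))
    (fun=> IH j) msk).2 _ mA'.
have -> : (fun v => v + c *: delta_mx ord0 ord0) \o @rV_cons R n =
    @rV_cons R n \o (fun p => (p.1 + c, p.2)).
  apply/funext => p; apply/rowP => k /=; rewrite !mxE.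
  case: unliftP => [k'|] ->; first by rewrite mulr0 addr0.
  by rewrite eqxx/= mulr1.
rewrite comp_preimage.
have msk : measurable_fun setT (fun p : R * 'rV[R]_n => (p.1 + c, p.2)).
  apply/measurable_fun_pairP; split; last exact: measurable_snd.
  apply: measurable_funD; last exact: measurable_cst.
  exact: measurable_fst.
exact: (measure_preserving_skew (measure_preserving_shift c)
  (fun=> measure_preserving_id (lebesgue_rV R n)) msk).2 _ mA'.
Qed.

Section heis_flows.
Context {n : nat}.
Local Notation T := ('rV[R]_n * 'rV[R]_n * measurableTypeR R)%type.

(** The flow translates [x_i], and [z] by an amount depending on [y_i], which it leaves fixed: a
    skew product of translations. *)
Lemma measure_preserving_Xflow (i : 'I_n) (t : R) :
  measure_preserving (lebesgue_heis R n) (fun p : T => p + t *: Xfield i p).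
Proof.
have mp1 : measure_preserving (prod_measure (lebesgue_rV R n) (lebesgue_rV R n))
    (fun w : 'rV[R]_n * 'rV[R]_n => (w.1 + t *: delta_mx ord0 i, w.2)).
  apply: (measure_preserving_skew (measure_preserving_rV i t)
    (fun=> measure_preserving_id (lebesgue_rV R n))).
  apply/measurable_fun_pairP; split; last exact: measurable_snd.
  exact: measurableT_comp (measure_preserving_rV i t).1 measurable_fst.
have -> : (fun p : T => p + t *: Xfield i p) =
    (fun p : T => ((p.1.1 + t *: delta_mx ord0 i, p.1.2), p.2 + - (t * (p.1.2 ord0 i / 2)))).
  by apply/funext => -[[x y] z]; congr (_, _, _); rewrite /= ?scaler0 ?addr0// scalerN.
apply: (measure_preserving_skew mp1
  (fun w : 'rV[R]_n * 'rV[R]_n => measure_preserving_shift (- (t * (w.2 ord0 i / 2))))).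
apply/measurable_fun_pairP; split.
  exact: measurableT_comp mp1.1 measurable_fst.
apply: measurable_funD; first exact: measurable_snd.
apply: measurableT_comp => //; apply: measurable_funM; first exact: measurable_cst.
apply: measurable_funM; last exact: measurable_cst.
apply: measurableT_comp (measurable_rV_coord i) _.
exact: measurableT_comp measurable_snd measurable_fst.
Qed.

Lemma measure_preserving_Yflow (i : 'I_n) (t : R) :
  measure_preserving (lebesgue_heis R n) (fun p : T => p + t *: Yfield i p).
Proof.
have mp1 : measure_preserving (prod_measure (lebesgue_rV R n) (lebesgue_rV R n))
    (fun w : 'rV[R]_n * 'rV[R]_n => (w.1, w.2 + t *: delta_mx ord0 i)).
  apply: (measure_preserving_skew (measure_preserving_id (lebesgue_rV R n))
    (fun=> measure_preserving_rV i t)).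
  apply/measurable_fun_pairP; split; first exact: measurable_fst.
  exact: measurableT_comp (measure_preserving_rV i t).1 measurable_snd.
have -> : (fun p : T => p + t *: Yfield i p) =
    (fun p : T => ((p.1.1, p.1.2 + t *: delta_mx ord0 i), p.2 + t * (p.1.1 ord0 i / 2))).
  by apply/funext => -[[x y] z]; congr (_, _, _); rewrite /= ?scaler0 ?addr0.
apply: (measure_preserving_skew mp1
  (fun w : 'rV[R]_n * 'rV[R]_n => measure_preserving_shift (t * (w.1 ord0 i / 2)))).
apply/measurable_fun_pairP; split.
  exact: measurableT_comp mp1.1 measurable_fst.
apply: measurable_funD; first exact: measurable_snd.
apply: measurable_funM; first exact: measurable_cst.
apply: measurable_funM; last exact: measurable_cst.
apply: measurableT_comp (measurable_rV_coord i) _.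
exact: measurableT_comp measurable_fst measurable_fst.
Qed.
End heis_flows.
End measure_preserving.

(** * The Hardy inequality along the flow of a field *)

Section flow_integral.
Context {R : realType} {n : nat}.
Local Notation H := (heis R n).
Local Notation T := ('rV[R]_n * 'rV[R]_n * measurableTypeR R)%type.
Local Notation mu := (lebesgue_heis R n).

Lemma continuous_support_integrable (g : H -> R) (B M : R) : continuous g ->
  (forall p, `|g p| <= B) -> (forall p, M < `|p| -> g p = 0) ->
  mu.-integrable setT ((fun p => (g p)%:E) : T -> \bar R).
Proof.
move=> cg gB gM; have mg := continuous_measurable_heis cg.
apply/integrableP; split; first exact/measurable_EFinP.
pose M1 : R := `|M| + 1.
have M10 : 0 < M1 by rewrite ltr_wpDl.
have B0 : 0 <= B by exact: le_trans (normr_ge0 _) (gB 0).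
pose D : set T := cube 0 M1.
have mD : measurable D by apply: measurable_cube; exact: ltW.
have [r r0 mur] := lebesgue_cube (0 : H) M10.
apply: (@le_lt_trans _ _ (\int[mu]_(p in D) (cst B%:E p))%E); last first.
  by rewrite integral_cst// [X in (_ * X)%E]mur -EFinM; exact: ltry.
rewrite [leRHS]integral_mkcond.
apply: ge0_le_integralT => p; first exact: abse_ge0.
rewrite patchE; case: ifPn => pc; first by rewrite /= lee_fin.
rewrite gM ?abse0//; move: pc; rewrite notin_setE /D/cube/= subr0 => /negP.
by rewrite -ltNge; apply: le_lt_trans; rewrite (le_trans (ler_norm _))// lerDl.
Qed.

Variable V : H -> H.
Hypothesis V_flow : forall p (t : R), V (p + t *: V p) = V p.
Hypothesis V_mp : forall t : R, measure_preserving mu ((fun p => p + t *: V p) : T -> T).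
Hypothesis V_bound : forall p, `|V p| <= 1 + `|p|.

(** The integral of [g (p + t *: V p)] does not depend on [t], so the difference quotients [f k]
    integrate to 0. They are bounded by [B'], by the mean value theorem, and vanish outside a fixed
    cube, so dominated convergence reaches [dg]. *)
Lemma integral_flow_derivative (g dg : H -> R) (B B' M : R) :
  continuous g -> continuous dg ->
  (forall p, `|g p| <= B) -> (forall p, `|dg p| <= B') ->
  (forall p, M < `|p| -> g p = 0) -> (forall p, M < `|p| -> dg p = 0) ->
  (forall p, is_derive (0 : R) 1 (fun t : R => g (p + t *: V p)) (dg p)) ->
  (\int[mu]_p (dg p)%:E = 0)%E.
Proof.
move=> cg cdg gB dgB gM dgM gdg.
(* By [V_flow], the derivative at time 0 from every point yields the derivative at every time. *)
have derg (p : H) (t : R) : is_derive t 1 (fun t : R => g (p + t *: V p)) (dg (p + t *: V p)).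
  set q := p + t *: V p.
  have -> : (fun t : R => g (p + t *: V p)) =
      (fun s : R => g (q + s *: V q)) \o shift (- t).
    apply/funext => s /=; rewrite /q V_flow -addrA -scalerDl.
    by congr (g (_ + _ *: _)); ring.
  rewrite -[X in is_derive _ _ _ X]mulr1; apply: is_derive1_comp.
    by rewrite /= subrr; exact: gdg.
  exact: is_derive_shift.
have lipg (p : H) (h : R) : 0 <= h -> `|g (p + h *: V p) - g p| <= B' * h.
  move=> h0.
  have H1 (x : R) : x \in `]0, h[ ->
      is_derive x 1 (fun t : R => g (p + t *: V p)) (dg (p + x *: V p)).
    by move=> _; exact: derg.
  have H2 : {within `[0, h], continuous (fun t : R => g (p + t *: V p))}.
    by apply: derivable_within_continuous => x _; apply: ex_derive; exact: derg.
  have [c _] := MVT_segment h0 H1 H2.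
  by rewrite scale0r addr0 subr0 => ->; rewrite normrM (ger0_norm h0) ler_wpM2r.
(* A point moved into the ball of radius [M] in time at most 1 had norm at most [M + (1 + M)], by
   [V_bound] at its image. *)
pose M' : R := M + (1 + M).
pose f (k : nat) (p : H) : R := k.+1%:R * (g (p + k.+1%:R^-1 *: V p) - g p).
have f0 k (p : H) : `|M'| + `|M| < `|p| -> f k p = 0.
  move=> Mp; have M'p : M' < `|p|.
    by apply: le_lt_trans Mp; rewrite (le_trans (ler_norm _))// lerDl.
  rewrite /f (gM p) ?gM ?subrr ?mulr0//; last first.
    by apply: le_lt_trans Mp; rewrite (le_trans (ler_norm _))// lerDr.
  rewrite ltNge; apply/negP => qM; move: M'p; rewrite ltNge => /negP; apply.
  set h : R := k.+1%:R^-1 in qM *; set q := p + h *: V p in qM *.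
  have -> : p = q - h *: V q by rewrite /q V_flow addrK.
  rewrite (le_trans (ler_normB _ _))// lerD// normrZ.
  have h1 : `|h| <= 1 by rewrite ger0_norm ?invr_ge0// invf_le1// ler1n.
  rewrite (le_trans (ler_piMl _ h1))// (le_trans (V_bound _))// lerD2l//.
have fB k (p : H) : `|f k p| <= B'.
  rewrite normrM ger0_norm// -ler_pdivlMl// mulrC; apply: lipg.
  by rewrite invr_ge0.
have ig : mu.-integrable setT ((fun p => (g p)%:E) : T -> \bar R).
  exact: continuous_support_integrable gB gM.
have mg : measurable_fun [set: T] ((fun p => (g p)%:E) : T -> \bar R).
  by apply/measurable_EFinP; exact: continuous_measurable_heis.
have mgV (t : R) : measurable_fun setT ((fun p => (g (p + t *: V p))%:E) : T -> \bar R).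
  exact: (measurableT_comp mg (V_mp t).1).
have igV (t : R) : mu.-integrable setT ((fun p => (g (p + t *: V p))%:E) : T -> \bar R).
  apply/integrableP; split=> //; have /integrableP[_] := ig; apply: le_lt_trans.
  have mag : measurable_fun [set: T] ((fun p => `|(g p)%:E|%E) : T -> \bar R).
    exact: measurableT_comp mg.
  have <- := ge0_integral_measure_preserving (V_mp t) mag (fun p => abse_ge0 _).
  exact: lexx.
have intf k : (\int[mu]_p (f k p)%:E = 0)%E.
  rewrite /f; under eq_integral do rewrite EFinM EFinB.
  rewrite integralZl//; last exact: integrableB.
  rewrite integralB//.
  rewrite (integral_measure_preserving (V_mp k.+1%:R^-1) mg) subee ?mule0//.
  exact: integrable_fin_num.
pose M1 : R := `|M'| + `|M| + 1.
have M10 : 0 < M1 by rewrite ltr_wpDl// addr_ge0.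
pose D : set T := cube 0 M1.
have mD : measurable D by apply: measurable_cube; exact: ltW.
have [r r0 mur] := lebesgue_cube (0 : H) M10.
have : (\int[mu]_p (f k p)%:E)%E @[k --> \oo] --> (\int[mu]_p (dg p)%:E)%E.
  apply: (@dominated_cvg _ _ _ mu setT measurableT (fun k p => (f k p)%:E) _
    (fun p => (B' * \1_D p)%:E)) => //.
  - move=> k; apply/measurable_EFinP; apply: measurable_funM; first exact: measurable_cst.
    have mgR := continuous_measurable_heis cg.
    exact: (measurable_funB (measurableT_comp mgR (V_mp k.+1%:R^-1).1) mgR).
  - move=> p _; apply: cvg_EFin; first exact: nearW.
    have [dgp <-] := gdg p; rewrite /derive.
    have /cvg_ex[l Hl] := dgp; rewrite (cvg_lim _ Hl)//.
    have := cvg_comp _ _ (@cvg_harmonic_dnbhs R) Hl.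
    apply: cvg_trans; apply: near_eq_cvg; apply: nearW => k.
    rewrite /f /= invrK scale0r !addr0.
    by rewrite [X in g (p + X *: _)](_ : _ = k.+1%:R^-1) //; exact: mulr1.
  - rewrite (_ : (fun p => _) = (fun p => B'%:E * (\1_D p)%:E)%E); last first.
      by apply/funext => p; rewrite EFinM.
    apply: integrableZl => //; apply/integrableP; split.
      exact/measurable_EFinP/measurable_indic.
    under eq_integral do rewrite gee0_abs ?lee_fin//.
    by rewrite integral_indic// setIT [ltLHS]mur ltry.
  - move=> k p _; rewrite /= lee_fin indicE; case: (boolP (p \in D)) => pD.
      by rewrite mulr1.
    rewrite f0 ?normr0 ?mulr0//; move: pD; rewrite notin_setE /D/cube/= subr0 => /negP.
    by rewrite -ltNge; apply: le_lt_trans; rewrite lerDl.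
under eq_fun do rewrite intf.
move=> /cvg_lim <- //; exact: lim_cst.
Qed.
End flow_integral.

(** * Comparison with the first Dirichlet eigenfunction *)

Section flow_hardy.
Context {R : realType} {n : nat}.
Local Notation H := (heis R n).
Local Notation T := ('rV[R]_n * 'rV[R]_n * measurableTypeR R)%type.
Local Notation mu := (lebesgue_heis R n).

(** [C] and the open complement of [K] cover the space wherever it matters: the weights used later
    are continuous on [C] and arbitrary outside, and a factor supported in [K] makes the product
    continuous everywhere. *)
Lemma continuous_supported (C K : set H) (w : H -> R) : closed K -> K `<=` C ->
  (forall p, C p -> {for p, continuous w}) -> (forall p, ~ K p -> w p = 0) -> continuous w.
Proof.
move=> cK KC Cw wK p; have [/Cw//|Cp] := pselect (C p).
have Kp : ~ K p by move=> /KC.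
rewrite /continuous_at (wK _ Kp); apply: cvg_near_cst.
apply: filterS (open_nbhs_nbhs (conj (closed_openC cK) Kp)) => q; exact: wK.
Qed.

Lemma compact_norm_bound (K : set H) : compact K ->
  exists M : R, forall p, M < `|p| -> ~ K p.
Proof.
move=> /compact_bounded [M [_ HM]]; exists (M + 1) => p Mp Kp.
have M1 : M < M + 1 by rewrite ltrDl.
by have /= := HM _ M1 p Kp; rewrite leNgt Mp.
Qed.

Lemma supported_bounded (K : set H) (w : H -> R) : compact K -> continuous w ->
  (forall p, ~ K p -> w p = 0) -> exists B : R, forall p, `|w p| <= B.
Proof.
move=> cK cw wK.
have cwK : compact (w @` K).
  by apply: continuous_compact => //; exact: continuous_subspaceT.
have [M [_ HM]] := @compact_bounded R R^o _ cwK.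
exists (`|M| + 1) => p; have [Kp|/wK ->] := pselect (K p).
  by apply: HM; [rewrite (le_lt_trans (ler_norm _))// ltrDl|exists p].
by rewrite normr0 addr_ge0.
Qed.

Lemma supported_integrable (K : set H) (w : H -> R) : compact K -> continuous w ->
  (forall p, ~ K p -> w p = 0) ->
  mu.-integrable setT ((fun p => (w p)%:E) : T -> \bar R).
Proof.
move=> cK cw wK; have [B wB] := supported_bounded cK cw wK.
have [M KM] := compact_norm_bound cK.
by apply: (continuous_support_integrable (M := M) cw wB) => p /KM /wK.
Qed.

Variable V : H -> H.
Hypothesis V_flow : forall p (t : R), V (p + t *: V p) = V p.
Hypothesis V_mp : forall t : R, measure_preserving mu ((fun p => p + t *: V p) : T -> T).
Hypothesis V_bound : forall p, `|V p| <= 1 + `|p|.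

(** [sigma] is the time along the line counted from the midpoint of the segment and [ell] the
    squared half-length, so [cos (kap * sigma)] is the eigenfunction. Its logarithmic derivative [f]
    satisfies [V f = - (kap^2 + f^2)], which makes [dg] the derivative of [g] along [V]. *)
Lemma flow_hardy (C K : set H) (u Vu sigma ell : H -> R) :
  compact K -> closed K -> K `<=` C ->
  continuous u -> continuous Vu -> (forall p, ~ K p -> u p = 0) ->
  (forall p, ~ K p -> Vu p = 0) ->
  (forall p, is_derive (0 : R) 1 (fun t : R => u (p + t *: V p)) (Vu p)) ->
  continuous sigma -> continuous ell ->
  (forall p (t : R), sigma (p + t *: V p) = sigma p + t) ->
  (forall p (t : R), ell (p + t *: V p) = ell p) ->
  (forall p, C p -> sigma p ^+ 2 < ell p) ->
  (\int[mu]_p (pi ^+ 2 / (4 * ell p) * u p ^+ 2)%:E <= \int[mu]_p (Vu p ^+ 2)%:E)%E.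
Proof.
move=> cK clK KC cu cVu uK VuK du csig cell sigf ellf sigell.
have ell0 p : C p -> 0 < ell p by move=> /sigell; apply: le_lt_trans; exact: sqr_ge0.
pose kap p := pi / (2 * Num.sqrt (ell p)).
have kap2 p : C p -> kap p ^+ 2 = pi ^+ 2 / (4 * ell p).
  move=> Cp; rewrite /kap expr_div_n exprMn sqr_sqrtr; last by rewrite ltW// ell0.
  by congr (_ / (_ * _)); ring.
(* [sigma^2 < ell] keeps [kap * sigma] strictly between [- pi / 2] and [pi / 2]. *)
have cosk p : C p -> cos (kap p * sigma p) != 0.
  move=> Cp; rewrite gt_eqF// cos_gt0_pihalf// -ltr_norml.
  have l0 := ell0 _ Cp.
  have sl : `|sigma p| < Num.sqrt (ell p).
    rewrite -(ltr_pXn2r (n := 2)) ?nnegrE ?sqrtr_ge0//.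
    by rewrite real_normK ?num_real// sqr_sqrtr ?sigell// ltW.
  have sl0 : 0 < Num.sqrt (ell p) by rewrite sqrtr_gt0.
  have k0 : 0 < kap p by rewrite divr_gt0 ?mulr_gt0// pi_gt0.
  rewrite normrM gtr0_norm//.
  have -> : pi / 2 = kap p * Num.sqrt (ell p) by rewrite /kap; field; rewrite gt_eqF.
  by rewrite ltr_pM2l.
pose f p := - (kap p * tan (kap p * sigma p)).
pose g p := u p ^+ 2 * f p.
pose dg p := 2 * u p * Vu p * f p - u p ^+ 2 * (kap p ^+ 2 + f p ^+ 2).
pose h p := kap p ^+ 2 * u p ^+ 2.
have ckap p : C p -> {for p, continuous kap}.
  move=> Cp; apply: continuousM; first exact: cst_continuous.
  apply: continuousV.
    by rewrite mulf_neq0// gt_eqF// sqrtr_gt0 ell0.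
  apply: continuousM; first exact: cst_continuous.
  apply: continuous_comp; first exact: cell.
  exact: sqrt_continuous.
have cf p : C p -> {for p, continuous f}.
  move=> Cp; apply: continuousN; apply: continuousM; first exact: ckap.
  apply: continuous_comp; first by apply: continuousM; [exact: ckap|exact: csig].
  by apply: continuous_tan; exact: cosk.
have cX (w : H -> R) p : {for p, continuous w} -> {for p, continuous (fun q => w q ^+ 2)}.
  by move=> cw; exact: (continuousM cw cw).
have gK p : ~ K p -> g p = 0 by move=> /uK up; rewrite /g up expr0n mul0r.
have dgK p : ~ K p -> dg p = 0.
  by move=> /uK up; rewrite /dg up expr0n mulr0 !mul0r subr0.
have hK p : ~ K p -> h p = 0 by move=> /uK up; rewrite /h up expr0n mulr0.
have cg : continuous g.
  apply: continuous_supported clK KC _ gK => p Cp.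
  by apply: continuousM; [apply: cX; exact: cu|exact: cf].
have cdg : continuous dg.
  apply: continuous_supported clK KC _ dgK => p Cp.
  apply: continuousB.
    apply: continuousM; last exact: cf.
    apply: continuousM; last exact: cVu.
    by apply: continuousM; [exact: cst_continuous|exact: cu].
  apply: continuousM; first by apply: cX; exact: cu.
  by apply: continuousD; apply: cX; [exact: ckap|exact: cf].
have ch : continuous h.
  apply: continuous_supported clK KC _ hK => p Cp.
  by apply: continuousM; apply: cX; [exact: ckap|exact: cu].
have cVu2 : continuous (fun p => Vu p ^+ 2) by move=> p; apply: cX; exact: cVu.
have Vu2K p : ~ K p -> Vu p ^+ 2 = 0 by move=> /VuK ->; rewrite expr0n.
have [B gB] := supported_bounded cK cg gK.
have [B' dgB] := supported_bounded cK cdg dgK.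
have [M KM] := compact_norm_bound cK.
have kapf p (t : R) : kap (p + t *: V p) = kap p by rewrite /kap ellf.
have gdg p : is_derive (0 : R) 1 (fun t : R => g (p + t *: V p)) (dg p).
  (* Off [C] the formula for [f] carries no information, but [g] vanishes along the line for small
     times because [K] is closed. *)
  have [Cp|Cp] := pselect (C p); last first.
    have Kp : ~ K p by move=> /KC.
    rewrite dgK//.
    apply: (near_eq_is_derive (f := cst (0 : R)) _ (is_derive_cst (0 : R) (0 : R) 1)).
    have cl : {for (0 : R), continuous (fun t : R => p + t *: V p)}.
      apply: cvgD; first exact: cvg_cst.
      by apply: cvgZr_tmp; exact: cvg_id.
    have nK : nbhs (p + 0 *: V p) (~` K).
      by rewrite scale0r addr0; apply: open_nbhs_nbhs (conj (closed_openC clK) Kp).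
    have nt : \forall t \near (0 : R), (~` K) (p + t *: V p) by exact: cl nK.
    by near=> t; apply/esym/gK; near: t.
  have dtan : is_derive (0 : R) 1 (fun t : R => tan (kap p * (sigma p + t)))
      (cos (kap p * sigma p) ^- 2 * kap p).
    apply: is_derive1_comp; first by rewrite addr0; exact: is_derive_tan (cosk _ Cp).
    apply: is_derive_eq (is_deriveM (is_derive_cst (kap p : R) (0 : R) 1)
      (is_deriveD (is_derive_cst (sigma p : R) (0 : R) 1) (is_derive_id (0 : R) 1))) _.
    by rewrite /GRing.scale/=; ring.
  have -> : (fun t : R => g (p + t *: V p)) = (fun t : R => u (p + t *: V p) *
      u (p + t *: V p) * ((- kap p) * tan (kap p * (sigma p + t)))).
    by apply/funext => t; rewrite /g /f kapf sigf mulNr expr2.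
  apply: is_derive_eq (is_deriveM (is_deriveM (du p) (du p))
    (is_deriveM (is_derive_cst (- kap p : R) (0 : R) 1) dtan)) _.
  rewrite [X in X *: _ + _](_ : _ = u p * u p); last first.
    by change (u (p + 0 *: V p) * u (p + 0 *: V p) = u p * u p); rewrite scale0r addr0.
  rewrite [X in _ + X *: _](_ : _ = - kap p * tan (kap p * sigma p)); last first.
    change (- kap p * tan (kap p * (sigma p + 0)) = - kap p * tan (kap p * sigma p)).
    by rewrite addr0.
  rewrite scale0r !addr0 cos2_tan2 ?cosk// /dg /f /GRing.scale/=.
  ring.
have int0 := integral_flow_derivative V_flow V_mp V_bound cg cdg gB dgB
  (fun p Mp => gK p (KM p Mp)) (fun p Mp => dgK p (KM p Mp)) gdg.
have ih := supported_integrable cK ch hK.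
have idg := supported_integrable cK cdg dgK.
have iVu := supported_integrable cK cVu2 Vu2K.
have -> : (\int[mu]_p (pi ^+ 2 / (4 * ell p) * u p ^+ 2)%:E =
           \int[mu]_p ((h p)%:E + (dg p)%:E))%E.
  rewrite integralD// int0 adde0; apply: eq_integral => p _; congr EFin.
  have [/KC Cp|/uK up] := pselect (K p); first by rewrite /h kap2.
  by rewrite /h up expr0n !mulr0.
apply: le_integral => //; first exact: integrableD.
move=> p _; rewrite -EFinD lee_fin.
have -> : h p + dg p = Vu p ^+ 2 - (Vu p - u p * f p) ^+ 2 by rewrite /h /dg; ring.
by rewrite gerBl sqr_ge0.
Unshelve. all: by end_near. Qed.
End flow_hardy.

(** * The Hardy inequality on a paraboloid *)

Section heis_fields.
Context {R : realType} {n : nat}.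
Local Notation H := (heis R n).

Lemma is_derive_line (u : H -> R) (p v : H) : derivable u p v ->
  is_derive (0 : R) 1 (fun t : R => u (p + t *: v)) ('D_v u p).
Proof.
move=> du.
have E : (fun h : R => h^-1 *: (((fun t : R => u (p + t *: v)) \o shift 0) (h *: (1 : R)) -
     u (p + 0 *: v))) = (fun h : R => h^-1 *: ((u \o shift p) (h *: v) - u p)).
  apply/funext => h /=; rewrite scale0r !addr0 (addrC p).
  by rewrite [X in X *: v](_ : _ = h)//; exact: mulr1.
apply: DeriveDef; first by rewrite /derivable E.
by rewrite /derive E.
Qed.

(** [smooth] speaks of derivatives along fixed vectors; writing the field with constant directions
    and variable coefficients gives the continuity of [X_i u]. *)
Lemma XfieldE (i : 'I_n) (p : H) : Xfield i p =
  ((delta_mx ord0 i, 0), 0) - (p.1.2 ord0 i / 2) *: ((0, 0), 1) :> H.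
Proof.
congr (_, _, _); rewrite /= ?scaler0 ?subr0//.
by rewrite sub0r; congr (- _); rewrite /GRing.scale/= mulr1.
Qed.

Lemma YfieldE (i : 'I_n) (p : H) : Yfield i p =
  ((0, delta_mx ord0 i), 0) + (p.1.1 ord0 i / 2) *: ((0, 0), 1) :> H.
Proof.
congr (_, _, _); rewrite /= ?scaler0 ?addr0//.
by rewrite add0r /GRing.scale/= mulr1.
Qed.

Lemma Xfield_flow (i : 'I_n) (p : H) (t : R) : Xfield i (p + t *: Xfield i p) = Xfield i p.
Proof. by rewrite /Xfield /= scaler0 addr0. Qed.

Lemma Yfield_flow (i : 'I_n) (p : H) (t : R) : Yfield i (p + t *: Yfield i p) = Yfield i p.
Proof. by rewrite /Yfield /= scaler0 addr0. Qed.

Lemma delta_coord_le (i j : 'I_n) (p : H) : `|(delta_mx ord0 i : 'rV[R]_n) ord0 j| <= 1 + `|p|.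
Proof.
rewrite mxE eqxx/= ger0_norm//; apply: (@le_trans _ _ 1); first by case: (j == i).
by rewrite lerDl.
Qed.

Lemma Xfield_bound (i : 'I_n) (p : H) : `|Xfield i p| <= 1 + `|p|.
Proof.
apply/heis_norm_leP; first by rewrite addr_ge0.
split=> [j|j|] /=; first exact: delta_coord_le.
  by rewrite mxE normr0 addr_ge0.
rewrite normrN normrM; have := ycoord_norm i p; have := normr_ge0 p.
rewrite (@ger0_norm _ 2^-1)//; lra.
Qed.

Lemma Yfield_bound (i : 'I_n) (p : H) : `|Yfield i p| <= 1 + `|p|.
Proof.
apply/heis_norm_leP; first by rewrite addr_ge0.
split=> [j|j|] /=; [by rewrite mxE normr0 addr_ge0|exact: delta_coord_le|].
rewrite normrM; have := xcoord_norm i p; have := normr_ge0 p.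
rewrite (@ger0_norm _ 2^-1)//; lra.
Qed.

Lemma sqnorm_shift (x : 'rV[R]_n) (i : 'I_n) (t : R) :
  sqnorm (x + t *: delta_mx ord0 i) = sqnorm x + 2 * t * x ord0 i + t ^+ 2.
Proof.
rewrite /sqnorm (bigD1 i)//= [in RHS](bigD1 i)//=.
rewrite (eq_bigr (fun j => x ord0 j ^+ 2)) => [|j ji].
  by rewrite !mxE !eqxx/= mulr1; ring.
by rewrite !mxE (negbTE ji) andbF mulr0 addr0.
Qed.

Lemma continuous_sqnorm (c : H -> 'rV[R]_n) :
  (forall i, continuous (fun p => c p ord0 i)) -> continuous (fun p => sqnorm (c p)).
Proof.
move=> cc p; rewrite /sqnorm /continuous_at; elim: (index_enum _) => [|i s IH].
  by under eq_fun do rewrite big_nil; rewrite big_nil; exact: cvg_cst.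
under eq_fun do rewrite big_cons; rewrite big_cons.
by apply: cvgD => //; exact: (cvgM (cc i p) (cc i p)).
Qed.

(** The integral line of [X_i] (resp. [Y_i]) through [p] meets the paraboloid in a
    segment. In the time parameter of the flow, [Xmid] (resp. [Ymid]) is the signed
    position of [p] with respect to the midpoint and [gap] is the product of the
    distances to the endpoints, so [Xmid ^+ 2 + gap] is the squared half-length. *)
Definition gap (a : R) (p : H) : R := a * p.2 - (sqnorm p.1.1 + sqnorm p.1.2).
Definition Xmid (a : R) (i : 'I_n) (p : H) : R := p.1.1 ord0 i + a / 4 * p.1.2 ord0 i.
Definition Ymid (a : R) (i : 'I_n) (p : H) : R := p.1.2 ord0 i - a / 4 * p.1.1 ord0 i.

Lemma continuous_gap (a : R) : continuous (gap a).
Proof.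
move=> p; apply: cvgB.
  by apply: cvgM; [exact: cvg_cst|exact: continuous_zcoord].
apply: cvgD; apply: continuous_sqnorm => i.
  exact: continuous_xcoord.
exact: continuous_ycoord.
Qed.

Lemma continuous_Xmid (a : R) i : continuous (Xmid a i).
Proof.
move=> p; apply: cvgD; first exact: continuous_xcoord.
by apply: cvgM; [exact: cvg_cst|exact: continuous_ycoord].
Qed.

Lemma continuous_Ymid (a : R) i : continuous (Ymid a i).
Proof.
move=> p; apply: cvgB; first exact: continuous_ycoord.
by apply: cvgM; [exact: cvg_cst|exact: continuous_xcoord].
Qed.

Lemma continuous_Xell (a : R) i : continuous (fun p => Xmid a i p ^+ 2 + gap a p).
Proof.
move=> p; have cX := @continuous_Xmid a i p; have cg := @continuous_gap a p.
exact: (continuousD (continuousM cX cX) cg).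
Qed.

Lemma continuous_Yell (a : R) i : continuous (fun p => Ymid a i p ^+ 2 + gap a p).
Proof.
move=> p; have cY := @continuous_Ymid a i p; have cg := @continuous_gap a p.
exact: (continuousD (continuousM cY cY) cg).
Qed.

Lemma Xmid_flow (a : R) i p (t : R) : Xmid a i (p + t *: Xfield i p) = Xmid a i p + t.
Proof. by rewrite /Xmid /= scaler0 addr0 !mxE !eqxx/= mulr1; ring. Qed.

Lemma Ymid_flow (a : R) i p (t : R) : Ymid a i (p + t *: Yfield i p) = Ymid a i p + t.
Proof. by rewrite /Ymid /= scaler0 addr0 !mxE !eqxx/= mulr1; ring. Qed.

(** Along the flow [gap] equals [gap a p - t^2 - 2 t Xmid a i p]; completing the square gives the
    invariant and accounts for the coefficient [a / 4] in [Xmid]. *)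
Lemma Xgap_flow (a : R) i p (t : R) :
  Xmid a i (p + t *: Xfield i p) ^+ 2 + gap a (p + t *: Xfield i p) =
  Xmid a i p ^+ 2 + gap a p.
Proof.
rewrite Xmid_flow /gap /Xmid /= scaler0 addr0 sqnorm_shift /GRing.scale/=.
by field.
Qed.

Lemma Ygap_flow (a : R) i p (t : R) :
  Ymid a i (p + t *: Yfield i p) ^+ 2 + gap a (p + t *: Yfield i p) =
  Ymid a i p ^+ 2 + gap a p.
Proof.
rewrite Ymid_flow /gap /Ymid /= scaler0 addr0 sqnorm_shift /GRing.scale/=.
by field.
Qed.

(** The cross terms of [Xmid^2 + Ymid^2] cancel, leaving [(1 + a^2 / 16) (x_i^2 + y_i^2)]; this is
    why the two fields are paired and where [16 + a^2] comes from. *)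
Lemma weight_ge (a : R) (i : 'I_n) (p : H) : 0 < a -> 0 < gap a p ->
  8 * pi ^+ 2 / (a * (16 + a ^+ 2) * p.2) <=
  pi ^+ 2 / (4 * (Xmid a i p ^+ 2 + gap a p)) + pi ^+ 2 / (4 * (Ymid a i p ^+ 2 + gap a p)).
Proof.
move=> a0 g0.
set lx := _ + gap a p; set ly := _ + gap a p.
have lx0 : 0 < lx by rewrite ltr_wpDl ?sqr_ge0.
have ly0 : 0 < ly by rewrite ltr_wpDl ?sqr_ge0.
have xr : p.1.1 ord0 i ^+ 2 <= sqnorm p.1.1.
  by rewrite /sqnorm (bigD1 i)//= lerDl; apply: sumr_ge0 => j _; exact: sqr_ge0.
have yr : p.1.2 ord0 i ^+ 2 <= sqnorm p.1.2.
  by rewrite /sqnorm (bigD1 i)//= lerDl; apply: sumr_ge0 => j _; exact: sqr_ge0.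
have z0 : 0 < p.2.
  rewrite -(pmulr_rgt0 _ a0); apply: lt_le_trans g0 _.
  by rewrite /gap gerBl addr_ge0 ?sqnorm_ge0.
(* Bound [x_i^2 + y_i^2] by the full squared norm and raise both coefficients to [2 + a^2 / 8];
   [gap] plus that norm is [a z]. *)
have lxy : lx + ly <= a * (16 + a ^+ 2) * p.2 / 8.
  have -> : a * (16 + a ^+ 2) * p.2 / 8 =
     (2 + a ^+ 2 / 8) * (gap a p + (sqnorm p.1.1 + sqnorm p.1.2)).
    by rewrite /gap; field.
  have -> : lx + ly = (1 + a ^+ 2 / 16) * (p.1.1 ord0 i ^+ 2 + p.1.2 ord0 i ^+ 2) + 2 * gap a p.
    by rewrite /lx /ly /Xmid /Ymid; field.
  have a2 : 0 <= a ^+ 2 by exact: sqr_ge0.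
  have s0 : 0 <= sqnorm p.1.1 + sqnorm p.1.2 by rewrite addr_ge0 ?sqnorm_ge0.
  have H1 : (1 + a ^+ 2 / 16) * (p.1.1 ord0 i ^+ 2 + p.1.2 ord0 i ^+ 2) <=
     (1 + a ^+ 2 / 16) * (sqnorm p.1.1 + sqnorm p.1.2).
    by rewrite ler_wpM2l ?lerD// addr_ge0// divr_ge0.
  apply: (le_trans (lerD H1 (lexx _))); rewrite [leRHS]mulrDr [leLHS]addrC.
  apply: lerD; first by rewrite ler_wpM2r ?(ltW g0)// lerDl divr_ge0.
  by rewrite ler_wpM2r//; lra.
clearbody lx ly.
have den0 : 0 < a * (16 + a ^+ 2) * p.2.
  by rewrite !mulr_gt0// ltr_wpDr ?sqr_ge0.
(* harmonic versus arithmetic mean: [1/lx + 1/ly >= 4/(lx + ly)] *)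
apply: (@le_trans _ _ (pi ^+ 2 / (lx + ly))).
  have -> : 8 * pi ^+ 2 / (a * (16 + a ^+ 2) * p.2) =
     pi ^+ 2 / (a * (16 + a ^+ 2) * p.2 / 8).
    by field; rewrite !gt_eqF// ltr_wpDr ?sqr_ge0.
  rewrite ler_wpM2l ?sqr_ge0// lef_pV2 ?posrE ?addr_gt0//.
  by rewrite divr_gt0.
have -> : pi ^+ 2 / (4 * lx) + pi ^+ 2 / (4 * ly) = pi ^+ 2 * ((lx + ly) / (4 * lx * ly)).
  by field; rewrite !gt_eqF.
rewrite ler_wpM2l ?sqr_ge0//.
rewrite -subr_ge0.
have -> : (lx + ly) / (4 * lx * ly) - (lx + ly)^-1 = (lx - ly) ^+ 2 / (4 * lx * ly * (lx + ly)).
  by field; rewrite !gt_eqF// addr_gt0.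
by rewrite divr_ge0 ?sqr_ge0// !mulr_ge0 ?addr_ge0// ltW.
Qed.

End heis_fields.

(** * From the weighted inequality to the Rayleigh quotient *)

Section hardy_paraboloid.
Context {R : realType} {n : nat}.
Local Notation H := (heis R n).
Local Notation T := ('rV[R]_n * 'rV[R]_n * measurableTypeR R)%type.
Local Notation mu := (lebesgue_heis R n).

Lemma hnorm_hgrad (u : H -> R) (p : H) : hnorm (hgrad u p) ^+ 2 =
  \sum_(i < n) ('D_(Xfield i p) u p ^+ 2 + 'D_(Yfield i p) u p ^+ 2).
Proof.
have -> : hgrad u p = frame_comb (\row_i 'D_(Xfield i p) u p) (\row_i 'D_(Yfield i p) u p) p.
  by rewrite /hgrad /frame_comb; apply: eq_bigr => i _; rewrite !mxE.
rewrite hnorm_frame_comb sqr_sqrtr; first by apply: eq_bigr => i _; rewrite !mxE.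
by apply: sumr_ge0 => i _; rewrite addr_ge0 ?sqr_ge0.
Qed.

(** A zero denominator has inverse [+oo], and the positive numerator then makes the quotient
    [+oo]. *)
Lemma le_ereal_ratio (num den : \bar R) (K B : R) : 0 < K -> 0 < B ->
  ((K * B)%:E <= num)%E -> (0 <= den)%E -> (den <= B%:E)%E -> (K%:E <= num / den)%E.
Proof.
move=> K0 B0 KB den0 denB.
have num0 : (0 < num)%E by apply: lt_le_trans KB; rewrite lte_fin mulr_gt0.
case: den den0 denB => [d| |]//; rewrite !lee_fin => d0 dB.
have [->|dN0] := eqVneq d 0.
  by rewrite inve0 gt0_muley// leey.
have {}d0 : 0 < d by rewrite lt_neqAle eq_sym dN0.
rewrite inver (negbTE dN0).
apply: le_trans (lee_wpmul2r _ KB); last by rewrite lee_fin invr_ge0 ltW.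
rewrite -EFinM lee_fin -mulrA ler_peMr//; first exact: ltW.
by rewrite ler_pdivlMr// mul1r.
Qed.

Lemma paraboloid_gap (a : R) (p : H) : paraboloid a%:E p = (0 < gap a p) :> Prop.
Proof. by rewrite /paraboloid /= -EFinM lte_fin /gap subr_gt0. Qed.

Lemma gap_z_gt0 (a : R) (p : H) : 0 < a -> 0 < gap a p -> 0 < p.2.
Proof.
move=> a0 g0; rewrite -(pmulr_rgt0 _ a0); apply: lt_le_trans g0 _.
by rewrite /gap gerBl addr_ge0 ?sqnorm_ge0.
Qed.

Lemma supported_integral_gt0 (K : set H) (w : H -> R) (p0 : H) : compact K -> continuous w ->
  (forall p, ~ K p -> w p = 0) -> (forall p, 0 <= w p) -> 0 < w p0 ->
  exists2 B : R, 0 < B & (\int[mu]_p (w p)%:E = B%:E)%E.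
Proof.
move=> cK cw wK w0 wp0.
have iw := supported_integrable cK cw wK.
have fw := integrable_fin_num measurableT iw.
exists (fine (\int[mu]_p (w p)%:E)%E); last by rewrite fineK.
rewrite -lte_fin fineK//.
have : \forall p \near p0, w p0 / 2 < w p.
  have h : w p0 / 2 < w p0 by rewrite ltr_pdivrMr// ltr_pMr// ltr1n.
  exact: (cvgr_gt (w p0) (cw p0) _ h).
move=> /nbhs_normP[e /= e0 He].
have e20 : 0 < e / 2 by rewrite divr_gt0.
have [r r0 mur] := lebesgue_cube p0 e20.
pose D : set T := cube p0 (e / 2).
have mD : measurable D by apply: measurable_cube; exact: ltW.
apply: (@lt_le_trans _ _ (\int[mu]_(p in D) (cst (w p0 / 2)%:E p))%E).
  rewrite integral_cst// [X in (_ * X)%E]mur -EFinM lte_fin mulr_gt0//.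
  by rewrite divr_gt0.
rewrite integral_mkcond; apply: ge0_le_integralT => p; rewrite patchE; case: ifPn => pD.
- by rewrite lee_fin divr_ge0// ltW.
- exact: lexx.
- rewrite lee_fin ltW//; apply: He => /=.
  move: pD; rewrite inE /D /cube/= distrC => /le_lt_trans; apply.
  by rewrite ltr_pdivrMr// ltr_pMr// ltr1n.
- by rewrite lee_fin.
Qed.

Section test_functions.
Variables (a : R) (u : H -> R).
Hypotheses (a0 : 0 < a) (tu : test_function (paraboloid a%:E) u).
Let K := closure [set p | u p != 0].

Let cK : compact K. Proof. by case: tu. Qed.
Let clK : closed K. Proof. exact: closed_closure. Qed.
Let KC : K `<=` paraboloid a%:E. Proof. by case: tu. Qed.
Let du (p : H) : differentiable u p. Proof. by case: tu => /(_ [::] p). Qed.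
Let dDu (v p : H) : differentiable (fun q => 'D_v u q) p.
Proof. by case: tu => /(_ [:: v] p). Qed.
Let cu : continuous u. Proof. by move=> p; exact: differentiable_continuous. Qed.
Let cDu (v : H) : continuous (fun q => 'D_v u q).
Proof. by move=> p; exact: differentiable_continuous. Qed.

Let uK p : ~ K p -> u p = 0.
Proof. by move=> Kp; apply: contrapT => /eqP up; apply: Kp; exact: subset_closure. Qed.

Let DuK (v p : H) : ~ K p -> 'D_v u p = 0.
Proof.
move=> Kp; rewrite -(derive_cst (0 : R) p v); apply: near_eq_derive.
by apply: filterS (open_nbhs_nbhs (conj (closed_openC clK) Kp)) => q /uK.
Qed.

Let DuD (p v w : H) (c : R) : 'D_(v + c *: w) u p = 'D_v u p + c * 'D_w u p.
Proof. by rewrite !deriveE// linearD linearZ. Qed.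

Let cXu i : continuous (fun p => 'D_(Xfield i p) u p).
Proof.
under eq_fun do rewrite XfieldE -scaleNr DuD.
move=> p; apply: cvgD; first exact: cDu.
apply: cvgM; last exact: cDu.
apply: cvgN; apply: cvgM; last exact: cvg_cst.
exact: continuous_ycoord.
Qed.

Let cYu i : continuous (fun p => 'D_(Yfield i p) u p).
Proof.
under eq_fun do rewrite YfieldE DuD.
move=> p; apply: cvgD; first exact: cDu.
apply: cvgM; last exact: cDu.
apply: cvgM; last exact: cvg_cst.
exact: continuous_xcoord.
Qed.

Let gapC (p : H) : paraboloid a%:E p -> 0 < gap a p.
Proof. by rewrite paraboloid_gap. Qed.

Let wX i (p : H) := pi ^+ 2 / (4 * (Xmid a i p ^+ 2 + gap a p)) * u p ^+ 2.
Let wY i (p : H) := pi ^+ 2 / (4 * (Ymid a i p ^+ 2 + gap a p)) * u p ^+ 2.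

Let hardyX i : (\int[mu]_p (wX i p)%:E <= \int[mu]_p ('D_(Xfield i p) u p ^+ 2)%:E)%E.
Proof.
apply: (flow_hardy (V := Xfield i) (sigma := Xmid a i)
  (ell := fun p => Xmid a i p ^+ 2 + gap a p) _ _ _ cK clK KC) => //.
- exact: Xfield_flow.
- exact: measure_preserving_Xflow.
- exact: Xfield_bound.
- by move=> p; exact: DuK.
- by move=> p; apply: is_derive_line; exact: diff_derivable.
- exact: continuous_Xmid.
- exact: continuous_Xell.
- exact: Xmid_flow.
- exact: Xgap_flow.
- by move=> p /gapC g0; rewrite ltrDl.
Qed.

Let hardyY i : (\int[mu]_p (wY i p)%:E <= \int[mu]_p ('D_(Yfield i p) u p ^+ 2)%:E)%E.
Proof.
apply: (flow_hardy (V := Yfield i) (sigma := Ymid a i)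
  (ell := fun p => Ymid a i p ^+ 2 + gap a p) _ _ _ cK clK KC) => //.
- exact: Yfield_flow.
- exact: measure_preserving_Yflow.
- exact: Yfield_bound.
- by move=> p; exact: DuK.
- by move=> p; apply: is_derive_line; exact: diff_derivable.
- exact: continuous_Ymid.
- exact: continuous_Yell.
- exact: Ymid_flow.
- exact: Ygap_flow.
- by move=> p /gapC g0; rewrite ltrDl.
Qed.

(** [W] is the majorant of [u^2 / delta^2] supplied by isoperimetry. On the cone [K0 * W] is [n]
    times the lower bound of [weight_ge] times [u^2], as [16 pi^3 / (2 pi) = 8 pi^2]. *)
Let K0 : R := n%:R / a * (16 * pi ^+ 3 / (16 + a ^+ 2)).
Let W (p : H) := u p ^+ 2 / (2 * pi * p.2).

Let cont_weight (w : H -> R) : (forall p, paraboloid a%:E p -> {for p, continuous w}) ->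
  continuous (fun p => w p * u p ^+ 2).
Proof.
move=> cw; apply: continuous_supported clK KC _ _ => [p Cp|p /uK ->].
  apply: continuousM; first exact: cw.
  have cup : {for p, continuous u} := @cu p.
  exact: (continuousM cup cup).
by rewrite expr0n mulr0.
Qed.

Lemma hardy_weighted :
  (\int[mu]_p (K0 * W p)%:E <= \int[mu]_p (hnorm (hgrad u p) ^+ 2)%:E)%E.
Proof.
have cwX i : continuous (wX i).
  apply: cont_weight => p /gapC g0; apply: continuousM; first exact: cst_continuous.
  apply: continuousV; first by rewrite mulf_neq0// gt_eqF// ltr_wpDl ?sqr_ge0.
  apply: continuousM; first exact: cst_continuous.
  exact: continuous_Xell.
have cwY i : continuous (wY i).
  apply: cont_weight => p /gapC g0; apply: continuousM; first exact: cst_continuous.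
  apply: continuousV; first by rewrite mulf_neq0// gt_eqF// ltr_wpDl ?sqr_ge0.
  apply: continuousM; first exact: cst_continuous.
  exact: continuous_Yell.
have mc (w : H -> R) : continuous w ->
    measurable_fun (setT : set T) ((fun p => (w p)%:E) : T -> \bar R).
  by move=> cw; apply/measurable_EFinP; exact: continuous_measurable_heis.
have w_ge0 (s : R) p : (pi ^+ 2 / (4 * (s ^+ 2 + gap a p)) * u p ^+ 2) >= 0.
  have [/KC/gapC g0|/uK ->] := pselect (K p); last by rewrite expr0n mulr0.
  by rewrite mulr_ge0 ?sqr_ge0// divr_ge0 ?sqr_ge0// mulr_ge0// addr_ge0 ?sqr_ge0// ltW.
have cX2 i : continuous (fun p => 'D_(Xfield i p) u p ^+ 2).
  move=> p; have cp : {for p, continuous (fun p => 'D_(Xfield i p) u p)} := @cXu i p.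
  exact: (continuousM cp cp).
have cY2 i : continuous (fun p => 'D_(Yfield i p) u p ^+ 2).
  move=> p; have cp : {for p, continuous (fun p => 'D_(Yfield i p) u p)} := @cYu i p.
  exact: (continuousM cp cp).
have sum_int (f g : 'I_n -> H -> R) :
    (forall i, continuous (f i)) -> (forall i, continuous (g i)) ->
    (forall i p, 0 <= f i p) -> (forall i p, 0 <= g i p) ->
    (\int[mu]_p (\sum_(i < n) (f i p + g i p))%:E =
     \sum_(i < n) (\int[mu]_p (f i p)%:E + \int[mu]_p (g i p)%:E))%E.
  move=> cf cg f0 g0; under eq_integral do rewrite -sumEFin.
  rewrite ge0_integral_sum//; last 2 first.
  - by move=> i; apply: mc => p; apply: cvgD; [exact: cf|exact: cg].
  - by move=> i p _; rewrite lee_fin addr_ge0.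
  apply: eq_bigr => i _; under eq_integral do rewrite EFinD.
  rewrite ge0_integralD//; first by move=> p _; rewrite lee_fin.
  - exact: mc.
  - by move=> p _; rewrite lee_fin.
  - exact: mc.
under [leRHS]eq_integral do rewrite hnorm_hgrad.
rewrite sum_int//; [|by move=> i p; exact: sqr_ge0..].
apply: (@le_trans _ _
  (\sum_(i < n) (\int[mu]_p (wX i p)%:E + \int[mu]_p (wY i p)%:E))%E); last first.
  by apply: lee_sum => i _; apply: leeD; [exact: hardyX|exact: hardyY].
rewrite -sum_int//; [|by move=> i p; exact: w_ge0..].
apply: ge0_le_integralT => p.
  rewrite lee_fin /W; have [/KC/gapC/(gap_z_gt0 a0) z0|/uK ->] := pselect (K p); last first.
    by rewrite expr0n mul0r mulr0.
  rewrite mulr_ge0//; last by rewrite divr_ge0 ?sqr_ge0// !mulr_ge0 ?pi_ge0// ltW.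
  by rewrite mulr_ge0 ?divr_ge0 ?addr_ge0 ?sqr_ge0 ?mulr_ge0 ?exprn_ge0 ?pi_ge0// ltW.
rewrite lee_fin /wX /wY /W.
have [/KC/gapC g0|/uK ->] := pselect (K p); last first.
  by rewrite expr0n mul0r mulr0 big1// => i _; rewrite !mulr0 addr0.
have z0 := gap_z_gt0 a0 g0.
under eq_bigr do rewrite -mulrDl.
rewrite -mulr_suml.
have -> : K0 * (u p ^+ 2 / (2 * pi * p.2)) =
    (\sum_(i < n) (8 * pi ^+ 2 / (a * (16 + a ^+ 2) * p.2))) * u p ^+ 2.
  rewrite sumr_const card_ord -mulr_natl /K0.
  move: (pi : R) (pi_gt0 R) (p.2) z0 => P P0 z z0; field.
  have a16 : 0 < 16 + a ^+ 2 by rewrite ltr_wpDr ?sqr_ge0.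
  by rewrite !gt_eqF.
rewrite ler_wpM2r ?sqr_ge0//; apply: ler_sum => i _.
exact: weight_ge.
Qed.

(** The integral [B] of [W] mediates: the energy is at least [K0 * B], the denominator at most [B],
    and [B] is finite and positive. *)
Lemma rayleigh_ge (p0 : H) : (0 < n)%N -> u p0 != 0 -> (K0%:E <= rayleigh (paraboloid a%:E) u)%E.
Proof.
move=> n0 up0.
have Kp0 : K p0 by exact: subset_closure.
have W0 p : 0 <= W p.
  have [/KC/gapC/(gap_z_gt0 a0) z0|/uK up] := pselect (K p).
    by rewrite /W divr_ge0 ?sqr_ge0// !mulr_ge0 ?pi_ge0// ltW.
  by rewrite /W up expr0n mul0r.
have Wp0 : 0 < W p0.
  have z0 := gap_z_gt0 a0 (gapC (KC Kp0)).
  by rewrite /W divr_gt0 ?exprn_even_gt0//= !mulr_gt0 ?pi_gt0.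
have cW : continuous W.
  rewrite /W; under eq_fun do rewrite mulrC.
  apply: cont_weight => p /gapC/(gap_z_gt0 a0) z0; apply: continuousV.
    by rewrite !mulf_neq0 ?gt_eqF// pi_gt0.
  by apply: continuousM; [exact: cst_continuous|exact: continuous_zcoord].
have WK p : ~ K p -> W p = 0 by move=> /uK up; rewrite /W up expr0n mul0r.
have [B B0 WB] := supported_integral_gt0 cK cW WK W0 Wp0.
have iW := supported_integrable cK cW WK.
have K00 : 0 < K0.
  by rewrite mulr_gt0 ?divr_gt0 ?mulr_gt0 ?exprn_gt0 ?pi_gt0 ?ltr0n// ltr_wpDr ?sqr_ge0.
rewrite /rayleigh; apply: (le_ereal_ratio K00 B0).
- rewrite EFinM -WB -integralZl//.
  (* Off the cone the gradient vanishes, so restricting the energy to it loses nothing. *)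
  apply: (le_trans hardy_weighted); rewrite [leRHS]integral_mkcond.
  apply: ge0_le_integralT => p; first by rewrite lee_fin sqr_ge0.
  rewrite patchE; case: ifPn => // /negP pC.
  have Kp : ~ K p by move=> /KC Cp; apply: pC; rewrite inE.
  rewrite hnorm_hgrad big1// => i _.
  by rewrite !DuK// expr0n addr0.
- apply: integral_ge0 => p _; rewrite mule_ge0 ?lee_fin ?sqr_ge0//.
  by rewrite inve_ge0 sqre_ge0.
- rewrite -WB integral_mkcond; apply: ge0_le_integralT => p; rewrite patchE.
    by case: ifP => // _; rewrite mule_ge0 ?lee_fin ?sqr_ge0// inve_ge0 sqre_ge0.
  case: ifPn => [|_]; last by rewrite lee_fin.
  rewrite inE => /gapC/(gap_z_gt0 a0) z0.
  have s0 : 0 < 2 * pi * p.2 by rewrite !mulr_gt0 ?pi_gt0.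
  have d2 : ((2 * pi * p.2)%:E <= cc_dist0 p ^+ 2)%E.
    have sd := cc_dist0_ge z0.
    rewrite -[X in X%:E]sqr_sqrtr ?(ltW s0)// EFin_expe lee_sqr//.
    by apply: le_trans sd; rewrite lee_fin sqrtr_ge0.
  rewrite real_normK ?num_real// /W [leRHS]EFinM.
  apply: lee_wpmul2l; first by rewrite lee_fin sqr_ge0.
  have -> : ((2 * pi * p.2)^-1%:E = (2 * pi * p.2)%:E^-1)%E by rewrite inver gt_eqF.
  by rewrite lee_pV2// ?inE ?sqre_ge0// lee_fin ltW.
Qed.
End test_functions.
End hardy_paraboloid.

Lemma rayleigh_ge0 (R : realType) (n : nat) (C : set (heis R n)) (u : heis R n -> R) :
  (0 <= rayleigh C u)%E.
Proof.
rewrite /rayleigh mule_ge0//.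
  by apply: integral_ge0 => p _; rewrite lee_fin sqr_ge0.
rewrite inve_ge0; apply: integral_ge0 => p _.
by rewrite mule_ge0 ?lee_fin ?sqr_ge0// inve_ge0 sqre_ge0.
Qed.

Lemma hardy_constant_paraboloid (R : realType) (n : nat) (a : R) : (0 < n)%N -> 0 < a ->
  ((n%:R / a * (16 * pi ^+ 3 / (16 + a ^+ 2)))%:E <=
    hardy_constant (paraboloid a%:E : set (heis R n)))%E.
Proof.
move=> n0 a0; apply: le_ereal_inf_tmp => _ [u [tu [p0 up0]] <-].
exact: (rayleigh_ge a0 tu n0 up0).
Qed.

Local Open Scope ereal_scope.

Theorem theorem21 (R : realType) (n : nat) (hn : (1 <= n)%N) :
  (forall S : set (heis R n), spherical_cap S ->
     let a := cap_parameter S in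
     (n%:R)%:E / a * ((16 * pi ^+ 3)%:E / (16%:E + a ^+ 2))
       <= cap_hardy_constant S) /\
  (forall M : R, exists2 e : R, (0 < e)%R &
     forall S : set (heis R n), spherical_cap S ->
       cap_parameter S < e%:E -> M%:E <= cap_hardy_constant S).
Proof.
split=> [S capS /=|M].
  have [a0 coneS] := cap_parameterP capS.
  rewrite /cap_hardy_constant coneS; case: (cap_parameter S) a0 => [a| |]// a0; last first.
    (* Full hemisphere: the inverse of [+oo] is 0, and the claim reduces to nonnegativity. *)
    rewrite invey mule0 mul0e; apply: le_ereal_inf_tmp => _ [u _ <-].
    exact: rayleigh_ge0.
  rewrite lte_fin in a0.
  have a16 : (0 < 16 + a ^+ 2)%R by rewrite ltr_wpDr ?sqr_ge0.
  rewrite -!EFinM -EFinD -expr2 !inver !gt_eqF// -!EFinM.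
  exact: hardy_constant_paraboloid.
(* With this [e], [a < e] gives both [a <= 1] and [M <= a^-1]. *)
have e0 : (0 < (`|M| + 1)^-1)%R by rewrite invr_gt0 ltr_wpDl.
exists (`|M| + 1)^-1%R => // S capS.
have [a0 coneS] := cap_parameterP capS.
rewrite /cap_hardy_constant coneS; case: (cap_parameter S) a0 => [a| |]//.
rewrite !lte_fin => a0 ae.
apply: le_trans (hardy_constant_paraboloid hn a0); rewrite lee_fin.
have Ma : (M <= a^-1)%R.
  have M1 : (0 < `|M| + 1)%R by rewrite ltr_wpDl.
  apply: (@le_trans _ _ (`|M| + 1)%R); first by rewrite (le_trans (ler_norm _))// lerDl.
  by rewrite -(invrK (`|M| + 1)%R) lef_pV2 ?posrE// ltW.
have a1 : (a <= 1)%R.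
  by rewrite (le_trans (ltW ae))// invf_le1 ?ltr_wpDl// lerDr.
(* Since [16 + a^2 <= 17] for [a <= 1], this makes the factor multiplying [n / a] at least 1. *)
have pi3 : (17 <= 16 * pi ^+ 3 :> R)%R.
  have p2 := @pi_ge2 R.
  have p4 : (4 <= pi ^+ 2 :> R)%R by rewrite expr2; nra.
  rewrite exprS; nra.
apply: (le_trans Ma); rewrite mulrAC.
rewrite ler_peMl ?invr_ge0 ?(ltW a0)//.
have a16 : (0 < 16 + a ^+ 2)%R by rewrite ltr_wpDr ?sqr_ge0.
have h1 : (1 <= 16 * pi ^+ 3 / (16 + a ^+ 2))%R.
  rewrite ler_pdivlMr// mul1r (le_trans _ pi3)//.
  have : (a ^+ 2 <= 1)%R by rewrite expr_le1// ltW.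
  lra.
by rewrite -[leLHS]mul1r ler_pM// ler1n.
Qed.
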